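(* Let $d,m\ge1$, let $\Pi_1,\dots,\Pi_d:\mathbb{R}^d\to\mathbb{R}$ be payoff functions, $\sigma_1,\dots,\sigma_d\in\mathbb{R}$, $D=\mathrm{diag}(\sigma_1^2,\dots,\sigma_d^2)$, and let the probability density $\rho(\cdot,t)$, $t\ge0$, satisfy $$\partial_t\rho=-\sum_{i=1}^d\frac{\partial}{\partial x_i}\Big(\rho\,\frac{\partial\Pi_i}{\partial x_i}\Big)+\frac12\sum_{i,j=1}^d\frac{\partial^2}{\partial x_i\partial x_j}\big(D_{ij}\rho\big),$$ with $d\lambda=\rho(x,0)\,dx$. For a pushforward map $T:\mathbb{R}^d\to\mathbb{R}^d$ put $$f(T)(z,t)=\Big(\tfrac{\partial\Pi_1}{\partial x_1}(T(z)),\dots,\tfrac{\partial\Pi_d}{\partial x_d}(T(z))\Big)^{\top}-\tfrac12D\,\nabla_x\log\rho(T(z),t).$$ Assume there is a constant $C>0$ such that for any two pushforward maps $T,\widetilde T$ and all $t\ge0$, $$\int\big|f(T)(z,t)-f(\widetilde T)(z,t)\big|^2d\lambda(z)\le C\int|T(z)-\widetilde T(z)|^2d\lambda(z).$$ Let $(T_\theta)_{\theta\in\Theta}$, $\Theta\subset\mathbb{R}^m$, be a parameterized family of pushforward maps, let $\rho_\theta=T_{\theta\sharp}\rho(\cdot,0)$, and define the projection error $$\delta_0=\sup_{t\ge0}\,\sup_{\theta\in\Theta}\,\min_{\xi\in\mathbb{R}^m}\int\Big|f(T_\theta)(z,t)-\frac{\partial T_\theta(z)}{\partial\theta}\,\xi\Big|^2d\lambda(z).$$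 Suppose $\theta:[0,\infty)\to\Theta$ evolves, from initial value $\theta(0)$, according to $$\dot\theta(t)=\widehat G(\theta(t))^{\dagger}\int\Big[\frac{\partial T_{\theta(t)}(z)}{\partial\theta}\Big]^{\top}f(T_{\theta(t)})(z,t)\,d\lambda(z),\qquad \widehat G(\theta)=\int\Big[\frac{\partial T_\theta(z)}{\partial\theta}\Big]^{\top}\frac{\partial T_\theta(z)}{\partial\theta}\,d\lambda(z),$$ where $\dagger$ is the Moore–Penrose pseudoinverse. Then for all $t\ge0$, $$W_2^2\big(\rho_{\theta(t)},\rho(\cdot,t)\big)\le e^{(1+2C)t}\,\epsilon_{\rho(\cdot,0)}+\frac{2\delta_0}{1+2C}\Big(e^{(1+2C)t}-1\Big),$$ where $\epsilon_{\rho(\cdot,0)}=W_2^2\big(\rho_{\theta(0)},\rho(\cdot,0)\big)$.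
   Context: $W_2$ is the Wasserstein-2 distance on $\mathbb{R}^d$ with Euclidean cost: $W_2^2(\rho_1,\rho_2)=\inf_\pi\iint|x-y|^2d\pi(x,y)$ over couplings $\pi$ of $\rho_1,\rho_2$. All densities are assumed to have finite second moment. A pushforward map is a measurable map $T:\mathbb{R}^d\to\mathbb{R}^d$ such that the image of $\lambda$ under $T$ is absolutely continuous with respect to Lebesgue measure with finite second moment; $T_\sharp\rho(\cdot,0)$ denotes its density. $\frac{\partial\Pi_i}{\partial x_i}$ is the partial derivative of player $i$'s payoff in its own variable, and $\partial T_\theta(z)/\partial\theta$ is the $d\times m$ Jacobian of $\theta\mapsto T_\theta(z)$. Standing assumptions: - The $\Pi_i$ are $C^1$, and $\rho$ is positive and smooth enough that $\nabla_x\log\rho$ is defined. - The equation $\frac{d}{dt}x_i(t)=\frac{\partial\Pi_i}{\partial x_i}(\pmb{x}(t))-\frac12\sigma_i^2\frac{\partial\log\rho}{\partial x_i}(\pmb{x}(t),t)$ ($i=1,\dots,d$) has a solution flow on $[0,\infty)$ for $\rho(\cdot,0)$-almost every starting point, measurable in the starting point, and if $\pmb{x}(0)$ has density $\rho(\cdot,0)$ then $\pmb{x}(t)$ has density $\rho(\cdot,t)$ for all $t\ge0$. - $T_\theta(z)$ is continuously differentiable in $\theta$, $\theta(\cdot)$ is $C^1$, $\partial_\theta T_\theta$ and $f(T)(\cdot,t)$ (for pushforward maps $T$) are square-integrable with respect to $\lambda$, and the second moments of $\rho(\cdot,t)$ and $\rho_{\theta(t)}$ are locally bounded in $t$. *)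

(* Defs.v *)
From HB Require Import structures.
From mathcomp Require Import all_boot all_order all_algebra.
From mathcomp Require Import all_classical all_reals all_analysis.
Set Implicit Arguments.
Unset Strict Implicit.
Unset Printing Implicit Defensive.
Import Order.TTheory GRing.Theory Num.Theory.
Import numFieldNormedType.Exports.
Local Open Scope classical_set_scope.
Local Open Scope ring_scope.

(** [R^n] is ['cV[R]_n] with the library's topology; the library's norm on it is
    the sup norm, hence [sqn] below for the Euclidean one. Its sigma-algebra is
    the product (equivalently, Borel) one, generated by the coordinates as for
    the library's [n.-tuple R]. *)
Definition measure_cV_display : measure_display.
Proof. exact: default_measure_display. Qed.

Definition cV_coord (R : realType) n (i : 'I_n) (x : 'cV[R]_n) : R := x i 0.

Section measurable_cV.
Context (R : realType) (n : nat).

Let cV_set0 : g_sigma_preimage (@cV_coord R n) set0.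
Proof. exact: sigma_algebra0. Qed.

Let cV_setC A : g_sigma_preimage (@cV_coord R n) A ->
  g_sigma_preimage (@cV_coord R n) (~` A).
Proof. exact: sigma_algebraC. Qed.

Let cV_bigcup (F : (set 'cV[R]_n)^nat) :
  (forall i, g_sigma_preimage (@cV_coord R n) (F i)) ->
  g_sigma_preimage (@cV_coord R n) (\bigcup_i (F i)).
Proof. exact: sigma_algebra_bigcup. Qed.

HB.instance Definition _ :=
  @isMeasurable.Build measure_cV_display 'cV[R]_n
    (g_sigma_preimage (@cV_coord R n)) cV_set0 cV_setC cV_bigcup.
End measurable_cV.

Lemma measurable_cV_coord (R : realType) n (i : 'I_n) :
  measurable_fun [set: 'cV[R]_n] (cV_coord i).
Proof.
move=> _ Y mY; rewrite setTI; apply: sub_sigma_algebra => /=.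
rewrite -bigcup_seq/=; exists i => /=; first by rewrite mem_index_enum.
by exists Y => //; rewrite setTI.
Qed.

Lemma measurable_fun_cVP d (T : measurableType d) (R : realType) n
    (f : T -> 'cV[R]_n) :
  measurable_fun [set: T] f <->
  forall i, measurable_fun [set: T] (fun x => f x i 0).
Proof.
split=> [mf i|mf].
  exact: (measurableT_comp (@measurable_cV_coord R n i) mf).
move=> _ A mA; rewrite setTI.
pose P : set (set 'cV[R]_n) := [set B | measurable (f @^-1` B)].
suff : g_sigma_preimage (@cV_coord R n) `<=` P by exact.
apply: smallest_sub.
  split=> [|B PB|F PF]; rewrite /P/=.
  - by rewrite preimage_set0.
  - by rewrite setTD preimage_setC; exact: measurableC.
  - by rewrite preimage_bigcup; exact: bigcupT_measurable.
move=> B; rewrite -bigcup_seq/= => -[i _ [C mC <-]].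
by have := mf i measurableT C mC; rewrite /P/= !setTI.
Qed.

Section cV_cons.
Context (R : realType) (n : nat).

Definition cV_cons (p : measurableTypeR R * 'cV[R]_n) : 'cV[R]_n.+1 :=
  \col_i (if unlift ord0 i is Some j then p.2 j 0 else p.1).

Lemma measurable_cV_cons : measurable_fun [set: _] cV_cons.
Proof.
apply/measurable_fun_cVP => i.
rewrite /cV_cons; case: (unliftP ord0 i) => [j|] ->.
  under eq_fun do rewrite mxE liftK.
  exact: (measurableT_comp (@measurable_cV_coord R n j) measurable_snd).
under eq_fun do rewrite mxE unlift_none.
exact: measurable_fst.
Qed.

Context (mu : {sigma_finite_measure set 'cV[R]_n -> \bar R}).

Definition lebesgue_cons : set 'cV[R]_n.+1 -> \bar R :=
  pushforward (@lebesgue_measure R \x mu)%E cV_cons.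

Let lebesgue_cons0 : lebesgue_cons set0 = 0%E.
Proof. by rewrite /lebesgue_cons /pushforward preimage_set0 measure0. Qed.

Let lebesgue_cons_ge0 A : (0 <= lebesgue_cons A)%E.
Proof. by apply: integral_ge0 => x _; exact: measure_ge0. Qed.

Let lebesgue_cons_sigma_additive : semi_sigma_additive lebesgue_cons.
Proof.
move=> F mF tF mUF; rewrite /lebesgue_cons /pushforward preimage_bigcup.
have mpre A : measurable A -> measurable (cV_cons @^-1` A).
  by move=> mA; rewrite -[X in measurable X]setTI; exact: measurable_cV_cons.
apply: measure_semi_sigma_additive.
- by move=> k; exact: mpre.
- apply/trivIsetP => /= i j _ _ ij; rewrite -preimage_setI.
  by move/trivIsetP : tF => /(_ _ _ _ _ ij) ->//; rewrite preimage_set0.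
- by rewrite -preimage_bigcup; exact: mpre.
Qed.

HB.instance Definition _ := isMeasure.Build _ _ _ lebesgue_cons
  lebesgue_cons0 lebesgue_cons_ge0 lebesgue_cons_sigma_additive.

Let cV_uncons (x : 'cV[R]_n.+1) : measurableTypeR R * 'cV[R]_n :=
  (x ord0 0, \col_j x (lift ord0 j) 0).

Let lebesgue_cons_sigma_finite : sigma_finite setT lebesgue_cons.
Proof.
have /sigma_finiteP[F [TF ndF Foo]] := sigma_finiteT (@lebesgue_measure R).
have /sigma_finiteP[G [TG ndG Goo]] := sigma_finiteT mu.
have mu_n : measurable_fun [set: _] cV_uncons.
  apply/measurable_fun_pairP; split => /=.
    exact: (@measurable_cV_coord R n.+1 ord0).
  apply/measurable_fun_cVP => j; under eq_fun do rewrite mxE.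
  exact: (@measurable_cV_coord R n.+1 (lift ord0 j)).
exists (fun k => cV_uncons @^-1` (F k `*` G k)).
  rewrite predeqE => x; split=> // _.
  have [i _ Fi] : (\bigcup_i F i) (x ord0 0) by rewrite -TF.
  have [j _ Gj] : (\bigcup_i G i) (\col_j x (lift ord0 j) 0) by rewrite -TG.
  exists (maxn i j) => //; split => /=.
    by move: Fi; exact/subsetPset/ndF/leq_maxl.
  by move: Gj; exact/subsetPset/ndG/leq_maxr.
move=> k; have [mFk Fk] := Foo k; have [mGk Gk] := Goo k.
have mFG : measurable (F k `*` G k) by exact: measurableX.
split; first by rewrite -[X in measurable X]setTI; exact: mu_n.
rewrite /lebesgue_cons /pushforward (_ : _ @^-1` _ = F k `*` G k).
  by rewrite product_measure1E// lte_mul_pinfty// ge0_fin_numE.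
rewrite -comp_preimage (_ : _ \o _ = id)//; apply/funext => -[a v] /=.
rewrite /cV_uncons mxE unlift_none; congr (_, _).
by apply/matrixP => i j; rewrite !mxE liftK ord1.
Qed.

HB.instance Definition _ := Measure_isSigmaFinite.Build _ _ _ lebesgue_cons
  lebesgue_cons_sigma_finite.

End cV_cons.

Fixpoint lebesgue_cV (R : realType) (n : nat) :
    {sigma_finite_measure set 'cV[R]_n -> \bar R} :=
  if n is n'.+1 then lebesgue_cons (lebesgue_cV R n') else \d_(0 : 'cV[R]_0).

Lemma lebesgue_cV_box (R : realType) n (a b : 'cV[R]_n) :
  (forall i, a i 0 <= b i 0) ->
  lebesgue_cV R n [set x | forall i, a i 0 < x i 0 <= b i 0] =
  (\prod_i (b i 0 - a i 0))%:E.
Proof.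
elim: n a b => [|n IHn] a b ab.
  by rewrite big_ord0 /= diracE mem_set// => -[].
rewrite big_ord_recl /= /lebesgue_cons /pushforward.
set a' : 'cV[R]_n := \col_j a (lift ord0 j) 0.
set b' : 'cV[R]_n := \col_j b (lift ord0 j) 0.
have mbox : measurable [set x : 'cV[R]_n | forall i, a' i 0 < x i 0 <= b' i 0].
  rewrite (_ : mkset _ =
    \bigcap_(i in [set: 'I_n]) (cV_coord i @^-1` `]a' i 0, b' i 0])).
    apply: fin_bigcap_measurable => // i _.
    by rewrite -[X in measurable X]setTI; apply: measurable_cV_coord.
  apply/seteqP; split=> x /= h i; first by move=> _; rewrite /= in_itv/=; exact: h.
  by have := h i I; rewrite /= in_itv.
transitivity ((@lebesgue_measure R \x lebesgue_cV R n)%E (`]a ord0 0, b ord0 0] `*`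
    [set x : 'cV[R]_n | forall i, a' i 0 < x i 0 <= b' i 0])); last first.
  rewrite product_measure1E//= IHn; last by move=> i; rewrite !mxE.
  rewrite lebesgue_measure_itv/= lte_fin; case: ltP => [_|ba].
    rewrite -EFinD -EFinM; congr (_ * _)%:E.
    by apply: eq_bigr => i _; rewrite !mxE.
  rewrite mul0e [X in X - _](_ : _ = a ord0 0) ?subrr ?mul0r//.
  by apply/eqP; rewrite eq_le ba ab.
congr product_measure1.
apply/seteqP; split=> [[u v]|[u v] [/= uab vab] i] /=.
  move=> h; split.
    by rewrite /= in_itv/=; have := h ord0; rewrite mxE unlift_none.
  by move=> i; have := h (lift ord0 i); rewrite !mxE liftK.
case: (unliftP ord0 i) => [j|] ->; rewrite mxE ?liftK ?unlift_none.
  by have := vab j; rewrite !mxE.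
by move: uab; rewrite in_itv.
Qed.

Section moore_penrose.
Context (R : realType).

Definition moore_penrose m n (A : 'M[R]_(m, n)) (B : 'M[R]_(n, m)) :=
  [/\ A *m B *m A = A, B *m A *m B = B,
      (A *m B)^T = A *m B & (B *m A)^T = B *m A].

(** Unlike the library's [pinvmx], which is only a partial inverse. *)
Definition mpinv m n (A : 'M[R]_(m, n)) : 'M[R]_(n, m) :=
  xget 0 [set B | moore_penrose A B].

Let gram_unit m n (A : 'M[R]_(m, n)) : row_free A -> A *m A^T \in unitmx.
Proof.
move=> Afree; rewrite -row_free_unit -kermx_eq0; apply/eqP/row_matrixP => i.
rewrite row0; set u := row i _.
have uA0 : u *m A = 0.
  have uAA : u *m A *m (u *m A)^T = 0.
    rewrite trmx_mul mulmxA -(mulmxA u) /u -row_mul mulmx_ker row0.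
    by rewrite mul0mx.
  have /eqP : \sum_k (u *m A) 0 k ^+ 2 = 0.
    transitivity ((u *m A *m (u *m A)^T) 0 0); last by rewrite uAA mxE.
    by rewrite mxE; apply: eq_bigr => k _; rewrite [_^T _ _]mxE expr2.
  rewrite psumr_eq0 => [/allP uA0|k _]; last exact: sqr_ge0.
  apply/rowP => j; rewrite [RHS]mxE; apply/eqP.
  by have := uA0 j; rewrite mem_index_enum sqrf_eq0 => /(_ isT).
by move/eqP: uA0; rewrite mulmx_free_eq0// => /eqP.
Qed.

Lemma moore_penrose_unique m n (A : 'M[R]_(m, n)) B B' :
  moore_penrose A B -> moore_penrose A B' -> B = B'.
Proof.
move=> [ABA BAB ABt BAt] [AB'A B'AB' AB't B'At].
have AB : A *m B = A *m B'.
  rewrite -ABt -{1}AB'A -mulmxA trmx_mul ABt AB't.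
  by rewrite mulmxA ABA.
have BA : B *m A = B' *m A.
  rewrite -BAt -{1}AB'A -!mulmxA mulmxA trmx_mul B'At BAt.
  by rewrite -mulmxA (mulmxA A) ABA.
by rewrite -BAB BA -mulmxA AB mulmxA.
Qed.

Lemma moore_penrose_mpinv m n (A : 'M[R]_(m, n)) : moore_penrose A (mpinv A).
Proof.
suff [B AB] : exists B, moore_penrose A B.
  by rewrite /mpinv; apply: (xgetPex 0 (ex_intro _ B AB)).
have [r [L [U [LU Lt Uf]]]] : exists r (L : 'M[R]_(m, r)) (U : 'M[R]_(r, n)),
    [/\ L *m U = A, row_free L^T & row_free U].
  exists (\rank A), (col_base A), (row_base A); split.
  - exact: mulmx_base.
  - by rewrite -row_leq_rank mxrank_tr col_leq_rank col_base_full.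
  - exact: row_base_free.
have uU : U *m U^T \in unitmx by exact: gram_unit.
have uL : L^T *m L \in unitmx by rewrite -[X in _ *m X]trmxK; exact: gram_unit.
pose GU := invmx (U *m U^T); pose GL := invmx (L^T *m L).
have GUt : GU^T = GU by rewrite trmx_inv trmx_mul trmxK.
have GLt : GL^T = GL by rewrite trmx_inv trmx_mul trmxK.
pose B := U^T *m GU *m GL *m L^T.
have AB : A *m B = L *m GL *m L^T.
  by rewrite -LU /B !mulmxA -(mulmxA L U) -(mulmxA L) mulmxV// mulmx1.
have BA : B *m A = U^T *m GU *m U.
  by rewrite -LU /B !mulmxA -(mulmxA _ L^T L) -(mulmxA _ GL) mulVmx// mulmx1.
exists B; split.
- by rewrite AB -{1}LU -!mulmxA (mulmxA L^T) (mulmxA GL) mulVmx// mul1mx LU.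
- by rewrite BA {1}/B /B !mulmxA -(mulmxA _ U U^T) -(mulmxA _ _ GU) mulmxV// mulmx1.
- by rewrite AB !trmx_mul trmxK GLt mulmxA.
- by rewrite BA !trmx_mul trmxK GUt mulmxA.
Qed.

End moore_penrose.

Section calculus.
Context (R : realType).

Definition partial n (g : 'cV[R]_n -> R) (i : 'I_n) (x : 'cV[R]_n) : R :=
  'D_(delta_mx i 0) g x.

Definition has_partial n (g : 'cV[R]_n -> R) (i : 'I_n) (x : 'cV[R]_n) :=
  derivable g x (delta_mx i 0).

Definition grad n (g : 'cV[R]_n -> R) (x : 'cV[R]_n) : 'cV[R]_n :=
  \col_i partial g i x.

Definition C1 n (g : 'cV[R]_n -> R) :=
  (forall x, differentiable g x) /\ forall i, continuous (partial g i).

(** [has_deriv_ge0 g t v]: [v] is the derivative at [t] of [g] seen as a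
    function on [[0, +oo[] only: two-sided for [0 < t], right-hand at [t = 0]. *)
Definition has_deriv_ge0 (V : normedModType R) (g : R -> V) (t : R) (v : V) :=
  h^-1 *: (g (t + h) - g t) @[h --> within [set h | 0 <= t + h] 0^'] --> v.

Definition sqn n (x : 'cV[R]_n) : R := \sum_i x i 0 ^+ 2.

End calculus.

Section transport.
Context (R : realType) (d : nat).
Local Notation X := 'cV[R]_d.
Implicit Types (mu nu : set X -> \bar R) (p : X -> R).
Local Open Scope ereal_scope.

Definition law p : set X -> \bar R :=
  fun A => \int[lebesgue_cV R d]_(x in A) (p x)%:E.

Definition prob_density p :=
  [/\ measurable_fun setT p, (forall x, (0 <= p x)%R) &
      \int[lebesgue_cV R d]_x (p x)%:E = 1].

Definition second_moment mu : \bar R := \int[mu]_x (sqn x)%:E.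

Definition coupling mu nu (pi : set (X * X) -> \bar R) :=
  forall A, measurable A ->
    pi (A `*` setT) = mu A /\ pi (setT `*` A) = nu A.

Definition W2sq mu nu : \bar R :=
  ereal_inf [set \int[pi]_xy (sqn (xy.1 - xy.2))%:E |
    pi in [set pi : probability (X * X)%type R | coupling mu nu pi]].

Definition pushforward_map (lam : probability X R) (T : X -> X) :=
  [/\ measurable_fun setT T,
      pushforward lam T `<< lebesgue_cV R d &
      second_moment (pushforward lam T) < +oo].

End transport.

Section game.
Context (R : realType) (d : nat).
Local Notation X := 'cV[R]_d.
Context (Pi : 'I_d -> X -> R) (sigma : 'I_d -> R) (rho : X -> R -> R).

Definition diffusion : 'M[R]_d := diag_mx (\row_i sigma i ^+ 2).

Definition fokker_planck := forall (t : R) (x : X), 0 <= t ->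
  [/\ forall i, has_partial (fun y => rho y t * partial (Pi i) i y) i x,
      forall i j, has_partial (fun y => diffusion i j * rho y t) j x,
      forall i j,
        has_partial (partial (fun y => diffusion i j * rho y t) j) i x &
      has_deriv_ge0 (rho x : R -> R^o) t
        (- \sum_i partial (fun y => rho y t * partial (Pi i) i y) i x +
         2^-1 * \sum_i \sum_j
           partial (partial (fun y => diffusion i j * rho y t) j) i x)].

(** [f(T)(z, t)] is [velocity (T z) t]; the right-hand side of the
    characteristic equation at the point [x] is [velocity x t]. *)
Definition velocity (x : X) (t : R) : X :=
  (\col_i partial (Pi i) i x) -
  2^-1 *: (diffusion *m grad (fun y => ln (rho y t)) x).

Definition solution_flow (lam : probability X R) (x : R -> X -> X) :=
  [/\ forall t : R, 0 <= t -> measurable_fun setT (x t),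
      {ae lam, forall z, x 0 z = z /\
        forall t : R, 0 <= t -> has_deriv_ge0 (x^~ z) t (velocity (x t z) t)} &
      forall t : R, 0 <= t -> forall A, measurable A ->
        pushforward lam (x t) A = law (rho^~ t) A].

Definition velocity_lipschitz (lam : probability X R) (C : R) :=
  forall T T' : X -> X, pushforward_map lam T -> pushforward_map lam T' ->
  forall t : R, 0 <= t ->
    (\int[lam]_z (sqn (velocity (T z) t - velocity (T' z) t))%:E <=
     C%:E * \int[lam]_z (sqn (T z - T' z))%:E)%E.

Section family.
Context (m : nat) (lam : probability X R).
Context (Theta : set 'cV[R]_m) (T : 'cV[R]_m -> X -> X).

Definition jac (th : 'cV[R]_m) (z : X) : 'M[R]_(d, m) :=
  \matrix_(i, j) partial (fun th' => T th' z i 0) j th.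

(** Only parameters in [Theta] matter. If [Theta] is not open, the values of
    [T] outside of it serve as a differentiable extension. *)
Definition C1_family := forall z : X,
  (forall th, Theta th -> differentiable (T^~ z) th) /\
  {within Theta, continuous (jac^~ z)}.

(** The inner minimum is attained when the integrands are square-integrable
    (orthogonal projection on a finite-dimensional subspace of L^2); it is
    written as an infimum in [\bar R]. *)
Definition projection_error : \bar R :=
  ereal_sup [set ereal_sup [set
    ereal_inf [set
      (\int[lam]_z (sqn (velocity (T th z) t - jac th z *m xi))%:E)%E
    | xi in [set: 'cV[R]_m]]
  | th in Theta] | t in [set t : R | 0 <= t]].

Definition gram (th : 'cV[R]_m) : 'M[R]_m :=
  \matrix_(i, j) \int[lam]_z ((jac th z)^T *m jac th z) i j.

Definition projected_velocity (th : 'cV[R]_m) (t : R) : 'cV[R]_m :=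
  mpinv (gram th) *m
  \col_j \int[lam]_z ((jac th z)^T *m velocity (T th z) t) j 0.

End family.
End game.

(* Main.v *)
(** A map equal to the identity off a Borel set [B] and to a translation by [h] on [B] is a
    pushforward map, so the Lipschitz hypothesis forces [velocity _ t] to be
    [sqrt C]-Lipschitz at almost every pair of points. Hence no optimal map between
    [rho_theta(0)] and [rho(., 0)] is needed: a coupling of these two laws is lifted, up to
    [eps], to a coupling [gam] of [lam] with itself that has a density with respect to
    [lam \x lam] (keep the masses of the cells of a fine grid, and make it proportional to
    a product measure inside each cell), and the integral [E(t)] over [gam] of
    [|T_theta(t)(z) - x(t, z')|^2] bounds the squared distance at time [t].

    With [a = J dtheta - v(T)], [b = v(T) - v(x)] and [c = T - x], the derivative of [|c|^2]
    is [2 <a + b, c> <= 2 |a|^2 + 2 |b|^2 + |c|^2], where [b] contributes at most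
    [2 C |c|^2], and the integral of [|a|^2] is at most [delta_0] because [dtheta] solves
    the normal equations of the projection. No bound uniform in time is available to
    differentiate under the integral sign. Instead, for each pair of labels,
    [exp(-(1 + 2 C) t) |c|^2] increases by at most the integral of the positive part of its
    derivative, and these inequalities are integrated with Tonelli's theorem. *)
From HB Require Import structures.
Require Import Defs.
From mathcomp Require Import all_boot all_order all_algebra.
From mathcomp Require Import all_classical all_reals all_analysis.
From mathcomp Require Import measurable_realfun ring lra zify.
Set Implicit Arguments.
Unset Strict Implicit.
Unset Printing Implicit Defensive.
Import Order.TTheory GRing.Theory Num.Theory.
Import numFieldNormedType.Exports.
Local Open Scope classical_set_scope.
Local Open Scope ring_scope.

(** * Growth of differentiable functions and of their expectations *)

Section deriv_pos.
Context {R : realType}.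
Implicit Types (f : R -> R) (T : R).

(* Continuous induction on the set of [y] such that the bound holds on [[0, y]]. *)
Lemma increment_le_measure (nu : {measure set (measurableTypeR R) -> \bar R}) f T : 0 <= T ->
  (forall x, 0 <= x <= T -> {for x, continuous f}) ->
  (forall x, 0 <= x < T -> \forall y \near x^'+,
     ((f y - f x)%:E <= nu `[x, y[%classic)%E) ->
  ((f T - f 0)%:E <= nu `[0%R, T[%classic)%E.
Proof.
move=> T0 cf fnu.
pose S := [set y | 0 <= y <= T /\ ((f y - f 0)%:E <= nu `[0%R, y[%classic)%E].
have S0 : S 0 by split; rewrite ?lexx//= subrr.
have hS : has_sup S by split; [exists 0|exists T => y [/andP[_ ->]]].
pose s := sup S.
have s0 : 0 <= s by apply: ub_le_sup => //; case: hS.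
have sT : s <= T by apply: ge_sup; [exists 0|move=> y [/andP[_ ->]]].
have nuS x y : x <= y -> (nu `[0%R, x[%classic <= nu `[0%R, y[%classic)%E.
  move=> xy; apply: le_measure; rewrite ?inE//.
  by apply: subset_itvl; rewrite bnd_simp.
(* The supremum is attained. Otherwise [nu [0, s[] is finite and less than [f s - f 0]; by
   continuity [f y - f 0] still exceeds it for [y] near [s], in particular for some [y <= s] in [S],
   although [f y - f 0 <= nu [0, y[ <= nu [0, s[] there. *)
have Ss : S s.
  split; first by rewrite s0.
  rewrite leNgt; apply/negP => nus.
  have : nu `[0%R, s[%classic \is a fin_num.
    by rewrite ge0_fin_numE// (lt_trans nus) ?ltry.
  move=> /fineK rE; set r := fine _ in rE.
  rewrite -rE lte_fin in nus.
  have : \forall y \near s, r < f y - f 0.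
    have : (fun y => f y - f 0) @ s --> f s - f 0.
      by apply: cvgB; [apply: cf; rewrite s0|exact: cvg_cst].
    by move=> /cvgr_gt; exact.
  move=> [e /= e0 He].
  have [y Sy sy] := @sup_adherent _ S e e0 hS.
  have ys : y <= s by apply: ub_le_sup => //; case: hS.
  have := He y; rewrite /ball/= ger0_norm ?subr_ge0// => /(_ _) rf.
  have {}rf : r < f y - f 0 by apply: rf; rewrite /s in sy *; lra.
  case: Sy => _ /le_trans /(_ (nuS _ _ ys)).
  by rewrite -rE lee_fin leNgt rf.
have [//|] : s = T \/ s < T by move: sT; rewrite le_eqVlt => /orP[/eqP|]; tauto.
  by move=> <-; case: Ss.
(* If [s < T], the local hypothesis at [s] and additivity over [[0, s[] and [[s, y[] put some
   [y > s] in [S]. *)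
move=> ltsT; exfalso.
have s0T : 0 <= s < T by rewrite s0.
have /filter_ex [y [[sy yT] fy]] : \forall y \near s^'+, (s < y /\ y <= T) /\
    ((f y - f s)%:E <= nu `[s, y[%classic)%E.
  apply: filterI; last exact: fnu.
  apply: filterI; first exact: nbhs_right_gt.
  exact: nbhs_right_le.
suff : S y by move=> /(ub_le_sup _) => /(_ (proj2 hS)); rewrite leNgt sy.
split; first by rewrite (le_trans s0 (ltW sy)).
have -> : f y - f 0 = (f s - f 0) + (f y - f s) by lra.
rewrite EFinD.
have -> : `[0%R, y[%classic = `[0%R, s[%classic `|` `[s, y[%classic.
  by rewrite -itv_bndbnd_setU// ?bnd_simp// ltW.
rewrite measureU//; first by apply: leeD => //; case: Ss.
rewrite -subset0 => z /= []; rewrite !in_itv/= => /andP[_ zs] /andP[sz _].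
by move: zs; rewrite ltNge sz.
Qed.

Lemma is_derive_near_right f (x l v : R) : is_derive x 1 f l -> l < v ->
  \forall y \near x^'+, f y - f x <= v * (y - x).
Proof.
move=> [dx fl] lv.
have : h^-1 *: (f (h *: 1 + x) - f x) @[h --> 0^'] --> l.
  by move/cvg_ex: dx => [/= l' Hl']; rewrite -fl [X in _ --> X](_ : _ = l')//; exact: cvg_lim.
move=> /cvgr_lt /(_ _ lv) [e /= e0 He].
near=> y.
have xy : x < y by near: y; exact: nbhs_right_gt.
have ye : y < x + e by near: y; apply: nbhs_right_lt; rewrite ltrDl.
have := He (y - x); rewrite /ball/= sub0r normrN gtr0_norm ?subr_gt0//.
move=> /(_ _ _)/=; rewrite [_ *: 1]mulr1 subrK => h.
have {}h : (y - x)^-1 * (f y - f x) < v by apply: h; [lra|rewrite subr_eq0 gt_eqF].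
by rewrite mulrC -ler_pdivrMl ?subr_gt0// ltW.
Unshelve. all: by end_near. Qed.

Local Notation mu := (@lebesgue_measure R).

(* The level sets [A k] of the positive part of [f'] are covered by
   open sets [W k] of almost the same measure; the measure [nu] of density
   [\sum_k (k + 1) e' \1_(W k)] dominates the increments of [f] to the right of every point. *)
Lemma le_integral_deriv_pos f f' T : 0 <= T ->
  (forall t, 0 <= t <= T -> is_derive t 1 f (f' t)) ->
  measurable_fun `[0, T[ f' ->
  ((f T - f 0)%:E <=
   \int[mu]_(x in `[0%R, T[) (Order.max 0 (f' x))%:E)%E.
Proof.
move=> T0 df mf'.
pose g x := Order.max 0 (f' x).
have mg : measurable_fun `[0, T[ g by apply: measurable_maxr.
have g0 x : 0 <= g x by rewrite le_max lexx.
apply/lee_addgt0Pr => e e0.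
(* The error is [e' T] from rounding [g] up to a multiple of [e'], plus [e'] from the excess measure
   of the sets [W k]: in all [e]. *)
pose e' := e / (T + 1).
have e'0 : 0 < e' by rewrite divr_gt0//; lra.
pose A k : set (measurableTypeR R) := `[0, T[ `&` [set x | k%:R * e' <= g x < k.+1%:R * e'].
have mA k : measurable (A k).
  have := mg (measurable_itv _) `[k%:R * e', k.+1%:R * e'[%classic (measurable_itv _).
  by congr (measurable _); apply/seteqP; split => x /=; rewrite /A/= !in_itv.
have Acover x : 0 <= x < T -> exists k, A k x.
  move=> x0T; exists (Num.truncn (g x / e')); split; first by rewrite /= in_itv.
  have /truncn_itv : 0 <= g x / e' by rewrite divr_ge0// ltW.
  by rewrite /= ler_pdivlMr// ltr_pdivrMr.
have AT k : A k `<=` `[0, T[ by move=> x [].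
have muA k : (mu (A k) < +oo)%E.
  apply: (@le_lt_trans _ _ (mu `[0%R, T[%classic)).
    apply: le_measure; rewrite ?inE; [exact: mA|exact: measurable_itv|exact: AT].
  by rewrite lebesgue_measure_itv/=; case: ifPn; rewrite ?ltry.
(* Weighted by [(k + 1) e'], the excess [c k] costs [e' / 2 ^ (k + 1)], which sums to [e']. *)
pose c k : R := e' / (2 ^ k.+1)%:R / k.+1%:R / e'.
have c0 k : 0 < c k by do 3 (apply: divr_gt0 => //); rewrite ltr0n expn_gt0.
have /choice[W HW] : forall k, exists U : set R,
    [/\ open U, A k `<=` U & (mu (U `\` A k) < (c k)%:E)%E].
  by move=> k; exact: (lebesgue_regularity_outer (mA k) (muA k) (c0 k)).
have mW k : measurable (W k) by apply: open_measurable; case: (HW k).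
have k0 k : 0 <= k.+1%:R * e' by rewrite mulr_ge0// ltW.
have kE k X : (0 <= (k.+1%:R * e')%:E * mu X)%E by rewrite mule_ge0 ?lee_fin.
pose nu := mseries (fun k => mscale (NngNum (k0 k)) (mrestr mu (mW k))) 0.
have nuE B : nu B = (\sum_(k <oo) (k.+1%:R * e')%:E * mu (B `&` W k))%E by [].
have : ((f T - f 0)%:E <= nu `[0%R, T[%classic)%E.
  apply: (@increment_le_measure nu) => //.
    move=> x x0; apply/differentiable_continuous/derivable1_diffP.
    by have [] := df _ x0.
  move=> x /andP[x0 xT].
  (* One term of the series is enough: [x] lies in some [A k], so [f' x < (k + 1) e'], and the open
     set [W k] contains [[x, y[] for [y] close to [x]. *)
  have [k Akx] : exists k, A k x by apply: Acover; rewrite x0.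
  have [oW AW _] := HW k.
  have /AW Wkx := Akx.
  have Wnb : nbhs x (W k) by apply: open_nbhs_nbhs; split.
  have fx : f' x < k.+1%:R * e'.
    by case: Akx => _ /= /andP[_]; apply: le_lt_trans; rewrite le_max lexx orbT.
  have {}fx := is_derive_near_right (df x _) fx.
  case: Wnb => d /= d0 Hd.
  near=> y.
  have xy : x < y by near: y; exact: nbhs_right_gt.
  have fxy : f y - f x <= k.+1%:R * e' * (y - x).
    by near: y; apply: fx; rewrite x0 ltW.
  have yd : y < x + d by near: y; apply: nbhs_right_lt; rewrite ltrDl.
  apply: (@le_trans _ _ ((k.+1%:R * e')%:E * mu (`[x, y[ `&` W k))%E).
    rewrite setIidl; last first.
      move=> z /=; rewrite in_itv/= => /andP[xz zy]; apply: Hd.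
      by rewrite /ball/= ltr_norml; apply/andP; split; lra.
    rewrite lebesgue_measure_itv/= lte_fin xy -EFinD -EFinM lee_fin.
    by [].
  suff : ((k.+1%:R * e')%:E * mu (`[x, y[ `&` W k) <= nu `[x, y[%classic)%E by [].
  rewrite nuE (@nneseriesD1 _ _ k)//.
  by rewrite leeDl// nneseries_ge0// => *; exact: kE.
move=> /le_trans; apply.
rewrite nuE.
apply: (@le_trans _ _ (\sum_(k <oo) ((k.+1%:R * e')%:E * mu (A k) +
    (e' / (2 ^ k.+1)%:R)%:E))%E).
  apply: lee_nneseries => [k _ _|k _]; first exact: kE.
  have -> : e' / (2 ^ k.+1)%:R = k.+1%:R * e' * c k.
    by rewrite /c; field; rewrite ?pnatr_eq0 ?expn_eq0 ?gt_eqF//.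
  rewrite [X in (_ <= _ + X)%E](_ : _ = ((k.+1%:R * e')%:E * (c k)%:E)%E)//.
  rewrite -ge0_muleDr//; last first.
    by rewrite lee_fin ltW.
  have [oW AW cW] := HW k.
  apply: lee_wpmul2l; first by rewrite lee_fin.
  apply: (@le_trans _ _ (mu (A k `|` W k `\` A k))).
    apply: le_measure; rewrite ?inE//; last by rewrite setDUK// => z [].
    - exact: (measurableI _ _ (measurable_itv _) (mW k)).
    - exact: (measurableU _ _ (mA k) (measurableD (mW k) (mA k))).
  have := @measureU2 _ _ _ mu _ _ (mA k) (measurableD (mW k) (mA k)).
  move=> /le_trans; apply.
 
  by rewrite leeD2l// ltW.
apply: (le_trans (epsilon_trick xpredT (fun k => kE k (A k)) (ltW e'0))).
apply: (@le_trans _ _ (\sum_(k <oo) (\int[mu]_(x in A k) ((g x)%:E + e'%:E)) + e'%:E)%E).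
  rewrite leeD2r//; apply: lee_nneseries => [k _ _|k _]; first exact: kE.
  have -> : ((k.+1%:R * e')%:E * mu (A k) = \int[mu]_(x in A k) (cst (k.+1%:R * e')%:E x))%E.
    by rewrite integral_cst.
  apply: ge0_le_integral => //.
  - by move=> x _; rewrite /= lee_fin.
  - apply/measurable_EFinP; apply: measurable_funD => //.
    by apply: measurable_funS mg.
  - move=> x [_ /= /andP[kg _]].
    rewrite -EFinD lee_fin -natr1 mulrDl mul1r lerD2r//.
have tA : trivIset setT A.
  apply/trivIsetP => i j _ _ ij; rewrite -subset0 => x [[_ /= /andP[i1 i2]] [_ /= /andP[j1 j2]]].
  have := le_lt_trans i1 j2; have := le_lt_trans j1 i2.
  rewrite !ltr_pM2r// !ltr_nat => ? ?.
  by move/eqP: ij; lia.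
have UA : \bigcup_k A k = `[0, T[%classic.
  apply/seteqP; split=> [x [k _ /AT]//|x]; rewrite /= in_itv/= => /Acover[k Akx].
  by exists k.
rewrite -ge0_integral_bigcup//; [rewrite UA| |]; last 2 first.
  by rewrite UA; apply: emeasurable_funD => //; exact/measurable_EFinP.
  by move=> x _; rewrite adde_ge0// lee_fin// ltW.
rewrite ge0_integralD//; [|by move=> ? _; rewrite lee_fin|exact/measurable_EFinP
  |by move=> ? _; rewrite lee_fin ltW].
have muT : (mu `[0%R, T[%classic = T%:E)%E.
  rewrite lebesgue_measure_itv/= lte_fin; case: ltP => // [_|T00].
    by rewrite -EFinD subr0.
  by congr EFin; apply/eqP; rewrite eq_le T0.
rewrite integral_cst// -addeA leeD2l// [X in (_ * X)%E](_ : _ = T%:E)//.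
rewrite -EFinM -EFinD lee_fin le_eqVlt; apply/orP; left; apply/eqP.
rewrite /e'; field; rewrite gt_eqF//; lra.
Unshelve. all: by end_near. Qed.
End deriv_pos.

(** * Joint measurability in time and sample point *)

Section caratheodory.
Context {R : realType} (d : measure_display) (Om : measurableType d).
Implicit Types F : R -> Om -> R.

Let D : set (measurableTypeR R * Om) := `[0, +oo[ `*` setT.

(** Rounding the time down to a multiple of [1 / (n + 1)] gives functions [Fn n] that do not depend
    on time within each of countably many slabs, hence are jointly measurable; by continuity in time
    they converge to [F]. *)
Lemma measurable_caratheodory F :
  (forall t w, 0 <= t -> {for t, continuous (F^~ w)}) ->
  (forall t, 0 <= t -> measurable_fun setT (F t)) ->
  measurable_fun D (fun p => F p.1 p.2).
Proof.
move=> cF mF.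
pose k n (t : R) := Num.truncn (t * n.+1%:R).
pose Fn n (p : measurableTypeR R * Om) := F ((k n p.1)%:R / n.+1%:R) p.2.
apply: (@measurable_fun_cvg _ _ _ _ Fn).
  move=> n mD Y mY.
  pose B j : set (measurableTypeR R * Om) :=
    `[j%:R / n.+1%:R, j.+1%:R / n.+1%:R[ `*` (F (j%:R / n.+1%:R) @^-1` Y).
  rewrite (_ : _ `&` _ = \bigcup_j B j).
    apply: bigcupT_measurable => j; apply: measurableX => //.
    rewrite -[X in measurable X]setTI; apply: mF => //.
  have n0 : 0 < n.+1%:R :> R by [].
  apply/seteqP; split => [[t w] [[/=]]|[t w] [j _ [/=]]].
    rewrite in_itv/= andbT => t0 _ FY; exists (k n t) => //; split => //=.
    have : 0 <= t * n.+1%:R by rewrite mulr_ge0.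
    by move=> /truncn_itv /andP[h1 h2]; rewrite in_itv/= ler_pdivrMr// ltr_pdivlMr// h1.
  rewrite in_itv/= => /andP[jt tj] FY.
  have t0 : 0 <= t by apply: le_trans jt; rewrite divr_ge0.
  split; first by split => //=; rewrite in_itv/= t0.
  rewrite /Fn/= (_ : k n t = j)//; apply/eqP; rewrite truncn_eq ?mulr_ge0//.
  by rewrite -ler_pdivrMr// jt -ltr_pdivlMr.
move=> [t w] [/=]; rewrite in_itv/= andbT => t0 _.
apply: (@cvg_comp _ _ _ (fun n => (k n t)%:R / n.+1%:R) (F^~ w) _ (nbhs t)); last exact: cF.
apply/cvgrPdist_le => e e0.
near=> n.
have n0 : 0 < n.+1%:R :> R by [].
have : 0 <= t * n.+1%:R by rewrite mulr_ge0.
move=> /truncn_itv /andP[]; rewrite -/(k n t) => h1 h2.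
have h3 : (k n t)%:R / n.+1%:R <= t by rewrite ler_pdivrMr.
rewrite ger0_norm ?subr_ge0//.
have : n.+1%:R^-1 <= e by near: n; apply: filterS (near_infty_natSinv_lt (PosNum e0)) => n /ltW.
apply: le_trans; rewrite lerBlDl -[X in _ + X]div1r -mulrDl natr1 ler_pdivlMr//.
exact: ltW.
Unshelve. all: by end_near. Qed.

(** The derivative is the limit of difference quotients of step [1 / (n + 1)], jointly measurable by
    the previous lemma. The steps are forward, so that times stay nonnegative. *)
Lemma measurable_joint_derivative F (F' : R -> Om -> R) :
  (forall (t : R) w, 0 <= t -> is_derive t 1 (F^~ w) (F' t w)) ->
  (forall t, 0 <= t -> measurable_fun setT (F t)) ->
  measurable_fun D (fun p => F' p.1 p.2).
Proof.
move=> dF mF.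
have cF t w : 0 <= t -> {for t, continuous (F^~ w)}.
  move=> t0; apply/differentiable_continuous/derivable1_diffP.
  by have [] := dF t w t0.
pose q n (p : measurableTypeR R * Om) := n.+1%:R * (F (p.1 + n.+1%:R^-1) p.2 - F p.1 p.2).
apply: (@measurable_fun_cvg _ _ _ _ q).
  move=> n; apply: measurable_funM => //; apply: measurable_funB.
    apply: (@measurable_caratheodory (fun t w => F (t + n.+1%:R^-1) w)).
      move=> t w t0.
      have t0' : 0 <= t + n.+1%:R^-1 by rewrite addr_ge0// invr_ge0.
      apply: (@cvg_comp _ _ _ (fun s : R => s + n.+1%:R^-1) (F^~ w) _ _ _ _ (cF _ w t0')).
      by apply: cvgD; [exact: cvg_id|exact: cvg_cst].
    by move=> t t0; apply: mF; rewrite addr_ge0// invr_ge0.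
  exact: measurable_caratheodory.
move=> [t w] [/=]; rewrite in_itv/= andbT => t0 _.
have [dx dE] := dF t w t0.
have H : h^-1 *: (F (h *: 1 + t) w - F t w) @[h --> 0^'] --> F' t w.
  by move/cvg_ex: dx => [/= l' Hl']; rewrite -dE [X in _ --> X](_ : _ = l')//; exact: cvg_lim.
have H2 : (fun n => n.+1%:R^-1 : R) @ \oo --> (0:R)^'.
  move=> A [e /= e0 He]; suff : \forall n \near \oo, A (n.+1%:R^-1) by [].
  near=> n; apply: He.
    rewrite /ball/= sub0r normrN ger0_norm ?invr_ge0//.
    by near: n; exact: (@near_infty_natSinv_lt _ (PosNum e0)).
  by rewrite /= invr_eq0 pnatr_eq0.
have E : (fun n => q n (t, w)) = (fun h : R => h^-1 *: (F (h *: 1 + t) w - F t w)) \o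
    (fun n : nat => n.+1%:R^-1).
  by apply/funext => n /=; rewrite invrK /q/= [_ *: 1]mulr1 (addrC t).
change ((fun n => q n (t, w)) @ \oo --> F' t w); rewrite E.
exact: (@cvg_comp _ _ _ _ _ _ _ _ H2 H).
Unshelve. all: by end_near. Qed.
End caratheodory.

(** * Gronwall estimate for expectations *)

Section expected_growth.
Context {R : realType} (d : measure_display) (Om : measurableType d) (gam : probability Om R).
Local Notation leb := (@lebesgue_measure R).

Lemma integral_expRN (K T : R) : 0 < K -> 0 <= T ->
  (\int[leb]_(s in `[0%R, T[) (expR (- K * s))%:E <= ((1 - expR (- K * T)) / K)%:E)%E.
Proof.
move=> K0; rewrite le_eqVlt => /orP[/eqP <-|T0].
  by rewrite set_itvco0 integral_set0 mulr0 expR0 subrr mul0r.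
have cE : continuous (fun s : R => expR (- K * s)).
  move=> s; apply: (@continuous_comp _ _ _ (fun s : R => - K * s) expR);
    last exact: continuous_expR.
  exact: mulrl_continuous.
pose G := fun s : R => - K^-1 * expR (- K * s).
have dG (s : R) : is_derive s 1 G (expR (- K * s)).
  rewrite /G; apply: is_derive_eq.
  by rewrite /GRing.scale /=; field; rewrite gt_eqF.
have cG : continuous G.
  move=> s; apply/differentiable_continuous/derivable1_diffP.
  by have [] := dG s.
apply: (@le_trans _ _ (\int[leb]_(s in `[0%R, T]) (expR (- K * s))%:E)%E).
  apply: ge0_subset_integral => //.
  - apply/measurable_EFinP; apply: measurable_funTS.
    exact: continuous_measurable_fun.
  - by apply: subset_itvl; rewrite bnd_simp.
rewrite (@continuous_FTC2 _ _ G)//.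
- rewrite -EFinD lee_fin /G mulr0 expR0 le_eqVlt; apply/orP; left; apply/eqP.
  by field; rewrite gt_eqF.
- exact: continuous_subspaceT.
- split.
  + by move=> s _; have [] := dG s.
  + exact: cvg_at_right_filter (cG 0).
  + exact: cvg_at_left_filter (cG T).
- by move=> s _; rewrite derive1E; have [_ ->] := dG s.
Qed.

(** For each [w], the increase of [exp (- K s) e(s, w)] is at most the integral of the positive part
    of its derivative. Integrating over [w] and exchanging the integrals by Tonelli's theorem
    leaves, at each time [s], at most [2 exp (- K s)] times the integral of [a]. Positivity takes
    the place of a dominating function. *)
Lemma expected_growth (e e' : R -> Om -> R) (K : R) (del : \bar R) (T : R) :
  0 < K -> 0 <= T ->
  (forall s w, 0 <= e s w) ->
  (forall s : R, 0 <= s -> measurable_fun setT (e s)) ->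
  (forall (s : R) w, 0 <= s -> is_derive s 1 (e^~ w) (e' s w)) ->
  (forall s : R, 0 <= s -> exists a : Om -> R,
    [/\ measurable_fun setT a, (forall w, 0 <= a w),
        {ae gam, forall w, e' s w <= K * e s w + 2 * a w} &
        (\int[gam]_w (a w)%:E <= del)%E]) ->
  (\int[gam]_w (e T w)%:E <= (expR (K * T))%:E * \int[gam]_w (e 0 w)%:E +
    (2 / K * (expR (K * T) - 1))%:E * del)%E.
Proof.
move=> K0 T0 e0 me de Ha.
pose f (s : R) w := expR (- K * s) * e s w.
pose f' (s : R) w := expR (- K * s) * (e' s w - K * e s w).
have df (s : R) w : 0 <= s -> is_derive s 1 (f^~ w) (f' s w).
  move=> s0; have := de s w s0 => dew.
  rewrite /f; apply: is_derive_eq.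
  by rewrite /f' /GRing.scale /=; ring.
have mf (s : R) : 0 <= s -> measurable_fun setT (f s).
  by move=> s0; apply: measurable_funM => //; exact: me.
have mf' := measurable_joint_derivative df mf.
pose DT : set (measurableTypeR R * Om) := `[0, T[ `*` setT.
(* The positive part of [f'], set to zero off [[0, T[ x Om] so that Tonelli's theorem applies on the
   whole product; nothing is known of [f'] at negative times. *)
pose H (p : measurableTypeR R * Om) : \bar R :=
  (((fun p => (Order.max 0 (f' p.1 p.2))%:E) \_ DT) p)%E.
have mH : measurable_fun setT H.
  apply/(measurable_restrictT _ _).1; first exact: measurableX.
  apply/measurable_EFinP; apply: measurable_maxr => //.
  apply: measurable_funS mf' => //.
    exact: measurableX.
  by move=> [s w] [/= + _]; rewrite !in_itv/= => /andP[-> _].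
have H0 p : (0 <= H p)%E.
  by rewrite /H patchE; case: ifPn => // _; rewrite lee_fin le_max lexx.
have HT w : (\int[leb]_s H (s, w) = \int[leb]_(s in `[0%R, T[) (Order.max 0 (f' s w))%:E)%E.
  rewrite [RHS]integral_mkcond; apply: eq_integral => s _; rewrite /H !patchE.
  by rewrite in_setX in_setT andbT.
have step1 w : ((f T w)%:E <= (f 0 w)%:E + \int[leb]_s H (s, w))%E.
  rewrite HT -leeBlDl// -EFinB; apply: (@le_integral_deriv_pos R (f^~ w) (f'^~ w) T T0).
    by move=> s /andP[s0 _]; exact: df.
  have : measurable_fun `[0, T[ ((fun p : measurableTypeR R * Om => f' p.1 p.2) \o
      (fun s : measurableTypeR R => (s, w))); last by [].
  have mD : measurable ((`[0%R, +oo[%classic : set (measurableTypeR R)) `*` [set: Om]).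
    exact: measurableX.
  have mm : measurable_fun (`[0%R, T[%classic : set (measurableTypeR R))
      (fun s : measurableTypeR R => (s, w)).
    by apply: measurable_funTS; exact: measurable_pair2.
  refine (measurable_comp mD _ mf' mm).
  by move=> _ [s + <-]; rewrite /= !in_itv/= => /andP[-> _]; split.
have step2 : (\int[gam]_w (f T w)%:E <=
    \int[gam]_w (f 0 w)%:E + \int[leb]_s \int[gam]_w H (s, w))%E.
  have mHw : measurable_fun setT (fun w => \int[leb]_s H (s, w))%E.
    exact: (measurable_fun_fubini_tonelli_G (m1 := leb) H).
  rewrite (fubini_tonelli H)// -ge0_integralD//.
  - apply: ge0_le_integral => //.
    + by move=> w _; rewrite lee_fin mulr_ge0// expR_ge0.
    + by apply/measurable_EFinP; exact: mf.
    + by apply: emeasurable_funD => //; apply/measurable_EFinP; exact: mf.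
  - by move=> w _; rewrite lee_fin mulr_ge0// expR_ge0.
  - by apply/measurable_EFinP; exact: mf.
  - by move=> w _; exact: integral_ge0.
have del0 : (0 <= del)%E.
  have [a [ma a0 _ ale]] := Ha 0 (lexx _).
  by apply: le_trans ale; apply: integral_ge0 => w _; rewrite lee_fin.
(* The growth hypothesis is used only after the exchange, with [s] fixed, because its exceptional
   null set may vary with [s]. *)
have step3 : (\int[leb]_s \int[gam]_w H (s, w) <= (2 * ((1 - expR (- K * T)) / K))%:E * del)%E.
  apply: (@le_trans _ _ (\int[leb]_(s in `[0%R, T[) ((expR (- K * s))%:E * (2%:E * del)))%E).
    rewrite [leRHS]integral_mkcond; apply: ge0_le_integral => //.
    - by move=> s _; exact: integral_ge0.
    - exact: (measurable_fun_fubini_tonelli_F (m2 := gam) H).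
    - apply/(measurable_restrictT _ _).1 => //.
      apply: emeasurable_funM => //; apply/measurable_EFinP; apply: measurable_funTS.
      by apply: measurableT_comp.
    - move=> s _; rewrite patchE; case: ifPn => sT; last first.
        rewrite integral0_eq// => w _.
        by rewrite /H patchE in_setX (negbTE sT).
      have /andP[s0 _] : 0 <= s < T by move: sT; rewrite inE/= in_itv.
      have [a [ma a0 aH ale]] := Ha s s0.
      apply: (@le_trans _ _ (\int[gam]_w ((expR (- K * s) * 2)%:E * (a w)%:E))%E).
        apply: ae_ge0_le_integral => //.
        + by apply: measurableT_comp => //; exact: measurable_pair1.
        + by move=> w _; rewrite -EFinM lee_fin !mulr_ge0// expR_ge0.
        + by apply: emeasurable_funM => //; exact/measurable_EFinP.
        + apply: filterS aH => w aw _.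
          rewrite /H patchE in_setX sT in_setT/= -EFinM lee_fin ge_max.
          rewrite !mulr_ge0 ?expR_ge0//=.
          rewrite /f' -mulrA ler_pM2l ?expR_gt0//.
          by rewrite lerBlDl.
      rewrite ge0_integralZl//; [|exact/measurable_EFinP|by move=> *; rewrite lee_fin].
      rewrite EFinM -muleA lee_pmul2l ?lte_fin ?expR_gt0//.
      by rewrite lee_pmul2l.
  rewrite ge0_integralZr//.
  - rewrite EFinM -muleA muleCA.
    by apply: lee_wpmul2r; [rewrite mule_ge0|exact: integral_expRN].
  - apply/measurable_EFinP; apply: measurable_funTS.
    by apply: measurableT_comp.
  - by rewrite mule_ge0.
have eT : (\int[gam]_w (e T w)%:E = (expR (K * T))%:E * \int[gam]_w (f T w)%:E)%E.
  rewrite -ge0_integralZl//.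
  - apply: eq_integral => w _; rewrite -EFinM /f mulrA -expRD.
    by rewrite mulNr subrr expR0 mul1r.
  - by apply/measurable_EFinP; exact: mf.
  - by move=> w _; rewrite lee_fin mulr_ge0// expR_ge0.
have e0f : (\int[gam]_w (e 0 w)%:E = \int[gam]_w (f 0 w)%:E)%E.
  by apply: eq_integral => w _; rewrite /f mulr0 expR0 mul1r.
rewrite eT e0f; apply: (@le_trans _ _ ((expR (K * T))%:E *
    (\int[gam]_w (f 0 w)%:E + (2 * ((1 - expR (- K * T)) / K))%:E * del))%E).
  apply: lee_wpmul2l; first by rewrite lee_fin expR_ge0.
  by apply: (le_trans step2); rewrite leeD2l.
rewrite ge0_muleDr//; [|by apply: integral_ge0 => w _; rewrite lee_fin mulr_ge0// expR_ge0
  |]; last first.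
  apply: mule_ge0 => //; rewrite lee_fin; apply: mulr_ge0 => //.
  apply: divr_ge0; last exact: ltW.
  by rewrite subr_ge0 -expR0 ler_expR mulNr oppr_le0 mulr_ge0// ltW.
rewrite leeD2l// muleA -EFinM.
rewrite (_ : expR (K * T) * _ = 2 / K * (expR (K * T) - 1))//.
by rewrite mulNr expRN; field; rewrite !gt_eqF ?expR_gt0.
Qed.
End expected_growth.

(** * Almost everywhere Lipschitz continuity *)

Section translation.
Context {R : realType}.
Local Notation leb := (@lebesgue_measure R).

Lemma measurable_shift (h : R) :
  measurable_fun [set: measurableTypeR R]
    (fun x : measurableTypeR R => x + h : measurableTypeR R).
Proof. by apply: (@measurable_funD _ _ R) => //; exact: measurable_cst. Qed.

Lemma ge0_integral_shift (f : R -> \bar R) (h : R) :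
  measurable_fun setT f -> (forall x, 0 <= f x)%E ->
  (\int[leb]_x f (x + h)%R = \int[leb]_x f x)%E.
Proof.
move=> mf f0.
have msh := measurable_shift h.
pose sft := (fun x : measurableTypeR R => x + h : measurableTypeR R).
transitivity (\int[pushforward leb sft]_x f x)%E.
  by rewrite (ge0_integral_pushforward msh)// preimage_setT.
apply: eq_measure_integral => /= A mA _.
have := @lebesgue_measure_unique R (pushforward leb sft).
move=> /(_ msh _ A mA) ->// X [[a b] /= _ <-].
rewrite /pushforward (_ : _ @^-1` _ = `]a - h, b - h]%classic); last first.
  by apply/seteqP; split => x /=; rewrite !in_itv/= ltrBlDr lerBrDr.
rewrite !lebesgue_measure_itv/= !lte_fin ltrD2r; case: ifP => // _.
by rewrite -!EFinD; congr EFin; lra.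
Qed.

Lemma measurable_cV_shift n (h : 'cV[R]_n) :
  measurable_fun setT (fun x : 'cV[R]_n => x + h).
Proof.
apply/measurable_fun_cVP => i; under eq_fun do rewrite mxE.
by apply: measurable_funD => //; exact: (measurable_cV_coord i).
Qed.

(** Induction on the dimension: the last coordinates are translated inside each section by the
    induction hypothesis, the first one in the outer integral. *)
Lemma lebesgue_cV_shift n (h : 'cV[R]_n) (A : set 'cV[R]_n) : measurable A ->
  lebesgue_cV R n ((fun x => x + h) @^-1` A) = lebesgue_cV R n A.
Proof.
elim: n h A => [|n IHn] h A mA.
  rewrite (_ : _ @^-1` _ = A)//; apply/seteqP; split => x /=;
  by rewrite (_ : x + h = x)//; apply/matrixP => -[].
rewrite /= /lebesgue_cons /pushforward.
have mcA : measurable (@cV_cons R n @^-1` A).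
  by rewrite -[X in measurable X]setTI; exact: measurable_cV_cons.
pose h' : 'cV[R]_n := \col_j h (lift ord0 j) 0.
pose phi x := lebesgue_cV R n (xsection (@cV_cons R n @^-1` A) x).
have mphi : measurable_fun setT phi by exact: measurable_fun_xsection.
transitivity (\int[leb]_x phi (x + h ord0 0)%R)%E; last by rewrite ge0_integral_shift.
apply: eq_integral => x _; rewrite /phi /=.
rewrite -[RHS](IHn h'); last exact: measurable_xsection.
congr (lebesgue_cV R n _); apply/seteqP; split => y /=; rewrite /xsection/= !inE/=;
  congr (A _); apply/matrixP => i j; rewrite !mxE ord1;
  by case: (unliftP ord0 i) => [k|] ->; rewrite ?liftK ?unlift_none ?mxE.
Qed.

End translation.

Section ae_lipschitz.
Context {R : realType} (d : nat).
Local Notation X := 'cV[R]_d.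
Local Notation leb := (lebesgue_cV R d).

Lemma sqn_ge0 n (x : 'cV[R]_n) : 0 <= sqn x.
Proof. by apply: sumr_ge0 => i _; exact: sqr_ge0. Qed.

Lemma sqn0 n : sqn (0 : 'cV[R]_n) = 0.
Proof. by rewrite /sqn big1// => i _; rewrite mxE expr0n. Qed.

Lemma sqnN n (x : 'cV[R]_n) : sqn (- x) = sqn x.
Proof. by apply: eq_bigr => i _; rewrite mxE sqrrN. Qed.

Lemma sqnD_le n (x y : 'cV[R]_n) : sqn (x + y) <= 2 * sqn x + 2 * sqn y.
Proof.
rewrite /sqn !mulr_sumr -big_split/=; apply: ler_sum => i _; rewrite mxE.
by have := sqr_ge0 (x i 0 - y i 0); nra.
Qed.

Lemma measurable_sqn dd (T : measurableType dd) n (f : T -> 'cV[R]_n) :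
  measurable_fun setT f -> measurable_fun setT (fun x => sqn (f x)).
Proof.
move=> /measurable_fun_cVP mf; rewrite /sqn.
apply: measurable_sum => i; exact: measurable_funX.
Qed.

Lemma measurable_cVB dd (T : measurableType dd) n (f g : T -> 'cV[R]_n) :
  measurable_fun setT f -> measurable_fun setT g ->
  measurable_fun setT (fun x => f x - g x).
Proof.
move=> /measurable_fun_cVP mf /measurable_fun_cVP mg; apply/measurable_fun_cVP => i.
by under eq_fun do rewrite !mxE; exact: measurable_funB.
Qed.

Lemma measurable_cVD dd (T : measurableType dd) n (f g : T -> 'cV[R]_n) :
  measurable_fun setT f -> measurable_fun setT g ->
  measurable_fun setT (fun x => f x + g x).
Proof.
move=> /measurable_fun_cVP mf /measurable_fun_cVP mg; apply/measurable_fun_cVP => i.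
by under eq_fun do rewrite !mxE; exact: measurable_funD.
Qed.

Lemma integral_cst_prob dd (T : measurableType dd) (P : probability T R) (r : R) :
  (\int[P]__ r%:E = r%:E)%E.
Proof.
transitivity (r%:E * P setT)%E; first exact: integral_cst.
by rewrite probability_setT mule1.
Qed.

Definition shift_on (B : set X) (h : X) (z : X) : X := z + \1_B z *: h.

Lemma measurable_shift_on B h : measurable B -> measurable_fun setT (shift_on B h).
Proof.
move=> mB; apply: measurable_cVD => //.
apply/measurable_fun_cVP => i; under eq_fun do rewrite mxE.
by apply: measurable_funM => //; exact: measurable_indic.
Qed.

(** For fixed [h], let [B] be the set of [z] for which the pair [(z, z + h)] violates the bound.
    Tested on [shift_on B h], the hypothesis bounds the integral over [B] of [|v(z) - v(z + h)|^2]
    by [C |h|^2 lam(B)], while the integrand exceeds [C |h|^2] on [B]; so [B] is null for [lam],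
    hence for Lebesgue measure. Fubini in [(z, h)] concludes. *)
Lemma ae_lipschitz (lam : probability X R) (v : X -> X) (C : R) :
  0 < C -> leb `<< lam -> measurable_fun setT v ->
  (forall h B, measurable B ->
    (\int[lam]_z (sqn (v z - v (shift_on B h z)))%:E <=
     C%:E * \int[lam]_z (sqn (z - shift_on B h z))%:E)%E) ->
  (leb \x leb)%E [set xy | C * sqn (xy.1 - xy.2) < sqn (v xy.1 - v xy.2)] = 0%E.
Proof.
move=> C0 leblam mv Hv.
pose N := [set xy : X * X | C * sqn (xy.1 - xy.2) < sqn (v xy.1 - v xy.2)].
pose G (xy : X * X) := sqn (v xy.1 - v xy.2) - C * sqn (xy.1 - xy.2).
have mG : measurable_fun setT G.
  apply: measurable_funB.
    by apply/measurable_sqn/measurable_cVB; exact: measurableT_comp.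
  by apply: measurable_funM => //; apply/measurable_sqn/measurable_cVB.
have NE : N = G @^-1` `]0, +oo[.
  by apply/seteqP; split => x /=; rewrite in_itv/= andbT subr_gt0.
have mN : measurable N by rewrite NE -[X in measurable X]setTI; exact: mG.
pose s (zh : X * X) := (zh.1, zh.1 + zh.2).
have ms : measurable_fun setT s.
  apply/measurable_fun_pairP; split; first exact: measurable_fst.
  exact: (@measurable_cVD _ (X * X)%type _ fst snd measurable_fst measurable_snd).
have mNs : measurable (s @^-1` N) by rewrite -[X in measurable X]setTI; exact: ms.
have step h : leb (ysection (s @^-1` N) h) = 0%E.
  set B := ysection _ h.
  have mB : measurable B by exact: measurable_ysection.
  apply: ((null_content_dominatesP _ _).1 leblam) => //.
  have BE z : B z <-> C * sqn h < sqn (v z - v (z + h)).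
    by rewrite /B /ysection/= inE /N/= opprD addNKr sqnN.
  have := Hv h B mB.
  have mz : measurable_fun setT (fun z => sqn (v z - v (shift_on B h z))).
    apply/measurable_sqn/measurable_cVB => //.
    by apply: measurableT_comp => //; exact: measurable_shift_on.
  have -> : (\int[lam]_z (sqn (z - shift_on B h z))%:E = (sqn h)%:E * lam B)%E.
    rewrite -integral_cst// [RHS]integral_mkcond; apply: eq_integral => z _.
    rewrite patchE /shift_on opprD addNKr sqnN indicE.
    by case: ifPn => zB; rewrite ?scale1r ?scale0r ?sqn0.
  have -> : (\int[lam]_z (sqn (v z - v (shift_on B h z)))%:E =
             \int[lam]_(z in B) (sqn (v z - v (z + h)))%:E)%E.
    rewrite [RHS]integral_mkcond; apply: eq_integral => z _.
    rewrite patchE /shift_on indicE.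
    by case: ifPn => zB; rewrite ?scale1r ?scale0r ?addr0 ?subrr ?sqn0.
  move=> le1.
  pose g z := sqn (v z - v (z + h)) - C * sqn h.
  have mg : measurable_fun setT g.
    apply: measurable_funB => //; apply/measurable_sqn/measurable_cVB => //.
    by apply: measurableT_comp => //; exact: measurable_cV_shift.
  have g0 z : B z -> 0 < g z by move=> /BE; rewrite subr_gt0.
  have g0' z : B z -> (0 <= (g z)%:E)%E by move=> /g0/ltW; rewrite lee_fin.
  have fl : (lam B \is a fin_num) by exact: fin_num_measure.
  have : (\int[lam]_(z in B) (g z)%:E + (C * sqn h)%:E * lam B <= (C * sqn h)%:E * lam B)%E.
    rewrite [X in (_ <= X * _)%E]EFinM -[X in (_ <= X)%E]muleA; apply: le_trans le1.
    rewrite -integral_cst// -ge0_integralD//.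
    - apply: ge0_le_integral => //.
      + by move=> z Bz; rewrite adde_ge0// ?g0'// lee_fin mulr_ge0 ?sqn_ge0// ltW.
      + by apply: emeasurable_funD => //; apply/measurable_EFinP; exact: measurable_funTS.
      + apply/measurable_EFinP/measurable_funTS/measurable_sqn/measurable_cVB => //.
        by apply: measurableT_comp => //; exact: measurable_cV_shift.
      + by move=> z _; rewrite -EFinD lee_fin subrK.
    - by apply/measurable_EFinP; exact: measurable_funTS.
    - by move=> z _; rewrite lee_fin mulr_ge0 ?sqn_ge0// ltW.
  rewrite -leeBrDr ?fin_numM// subee ?fin_numM// => gle0.
  have gi0 : (\int[lam]_(z in B) (g z)%:E = 0)%E.
    by apply/eqP; rewrite eq_le gle0 integral_ge0.
  have := ae_eq_integral_abs lam mB (f := EFin \o g).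
  move=> /(_ _)[|H _]; first by apply/measurable_EFinP; exact: measurable_funTS.
  have /H [A [mA A0 BA]] : (\int[lam]_(z in B) `|(EFin \o g) z| = 0)%E.
    rewrite -gi0; apply: eq_integral => z /set_mem Bz.
    by rewrite /= ger0_norm// ltW// g0.
  apply: (subset_measure0 mB mA _ A0) => z Bz; apply: BA => /= /(_ Bz) [].
  by move=> gz; have := g0 _ Bz; rewrite gz ltxx.
have : (leb \x leb)%E N = (\int[leb]_z leb (xsection (s @^-1` N) z))%E.
  apply: eq_integral => x _ /=.
  rewrite -(lebesgue_cV_shift x); last exact: measurable_xsection.
  congr (leb _); apply/seteqP; split => y /=; rewrite /xsection/= !inE /s/=.
    by rewrite addrC.
  by rewrite addrC.
rewrite -/N => ->.
have := @indic_fubini_tonelli _ _ _ _ R leb leb _ mNs.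
have -> : fubini_F leb (EFin \o \1_(s @^-1` N)) = leb \o xsection (s @^-1` N).
  exact: indic_fubini_tonelli_FE.
have -> : fubini_G leb (EFin \o \1_(s @^-1` N)) = leb \o ysection (s @^-1` N).
  exact: indic_fubini_tonelli_GE.
by move=> ->; apply: integral0_eq => h _ /=; exact: step.
Qed.
End ae_lipschitz.

(** * Lifting of couplings *)

Section discretize.
Context {R : realType} (dX dY dZ : measure_display)
  (X : measurableType dX) (Y : measurableType dY) (Z : measurableType dZ).
Context (S : Z -> X) (mS : measurable_fun setT S) (mu : probability Z R) (nu : probability Y R).
Context (pi : probability (X * Y)%type R).
Hypothesis pi1 : forall A, measurable A -> pi (A `*` setT) = mu (S @^-1` A).
Hypothesis pi2 : forall A, measurable A -> pi (setT `*` A) = nu A.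
Context (P : nat -> set X) (Q : nat -> set Y).
Hypotheses (mP : forall k, measurable (P k)) (mQ : forall k, measurable (Q k)).
Hypotheses (tP : trivIset setT P) (tQ : trivIset setT Q).
Hypotheses (cP : \bigcup_k P k = setT) (cQ : \bigcup_k Q k = setT).

Lemma nneseries_partition d (T : measurableType d) (m : {measure set T -> \bar R})
    (F : nat -> set T) (A : set T) : (forall k, measurable (F k)) ->
  trivIset setT F -> \bigcup_k F k = setT -> measurable A ->
  (\sum_(k <oo) m (A `&` F k) = m A)%E.
Proof.
move=> mF tF cF mA; rewrite -[in RHS](setIT A) -cF setI_bigcupr measure_bigcup//.
- by apply: eq_eseriesl => i; rewrite mem_set.
- by move=> k _; exact: measurableI.
- by apply: trivIset_setIl.
Qed.

Definition cell k l : set (X * Y) := P k `*` Q l.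

Definition lifted_cell k l : set (Z * Y) := (S @^-1` P k) `*` Q l.

Lemma measurable_cell k l : measurable (cell k l).
Proof. exact: measurableX. Qed.

Lemma measurable_preimage_part k : measurable (S @^-1` P k).
Proof. by rewrite -[X in measurable X]setTI; exact: mS. Qed.

Lemma measurable_lifted_cell k l : measurable (lifted_cell k l).
Proof. by apply: measurableX => //; exact: measurable_preimage_part. Qed.

Let tSP : trivIset setT (fun k => S @^-1` P k).
Proof.
apply/trivIsetP => i j _ _ ij; rewrite -preimage_setI.
by move/trivIsetP : tP => /(_ i j I I ij) ->; rewrite preimage_set0.
Qed.

Let cSP : \bigcup_k (S @^-1` P k) = setT.
Proof. by rewrite -preimage_bigcup cP preimage_setT. Qed.

(* When [pi (cell k l)] is positive, so is the denominator; otherwise the quotient is 0. *)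
Definition cell_weight k l : R :=
  fine (pi (cell k l)) / (fine (mu (S @^-1` P k)) * fine (nu (Q l))).

Lemma cell_weight_ge0 k l : 0 <= cell_weight k l.
Proof. by rewrite divr_ge0// ?mulr_ge0//; exact: fine_ge0. Qed.

Definition cell_measure k l :=
  mscale (NngNum (cell_weight_ge0 k l)) (mrestr (mu \x nu)%E (measurable_lifted_cell k l)).

Definition cell_row k := mseries (cell_measure k) 0.

(** On each [lifted_cell k l] this is the multiple of [mu \x nu] whose total mass is
    [pi (cell k l)]. *)
Definition cell_coupling := mseries cell_row 0.

HB.instance Definition _ := Measure.copy cell_coupling (mseries cell_row 0).

Lemma cell_couplingE A :
  cell_coupling A = (\sum_(k <oo) \sum_(l <oo)
    ((cell_weight k l)%:E * (mu \x nu) (A `&` lifted_cell k l)))%E.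
Proof. by []. Qed.

Let muE k : mu (S @^-1` P k) = (fine (mu (S @^-1` P k)))%:E.
Proof. by rewrite fineK// fin_num_measure//; exact: measurable_preimage_part. Qed.

Let nuE k : nu (Q k) = (fine (nu (Q k)))%:E.
Proof. by rewrite fineK// fin_num_measure. Qed.

Let piE k l : pi (cell k l) = (fine (pi (cell k l)))%:E.
Proof. by rewrite fineK// fin_num_measure//; exact: measurable_cell. Qed.

Let prodE A B : measurable A -> measurable B ->
  (mu \x nu)%E (A `*` B) = (fine (mu A) * fine (nu B))%:E.
Proof.
by move=> mA mB; rewrite product_measure1E// EFinM !fineK// fin_num_measure.
Qed.

(** This fact and the next settle the cells where the denominator of [cell_weight] vanishes: they
    lie in a null strip, so there is no mass to lift. *)
Let pi_mu0 k l : fine (mu (S @^-1` P k)) = 0 -> fine (pi (cell k l)) = 0.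
Proof.
move=> P0; apply/eqP; rewrite -eqe -piE eq_le measure_ge0 andbT.
have := muE k; rewrite P0 -pi1// => <-; apply: le_measure; rewrite ?inE//.
- exact: measurable_cell.
- exact: measurableX.
- by move=> [x y] [].
Qed.

Let pi_nu0 k l : fine (nu (Q l)) = 0 -> fine (pi (cell k l)) = 0.
Proof.
move=> P0; apply/eqP; rewrite -eqe -piE eq_le measure_ge0 andbT.
have := nuE l; rewrite P0 -pi2// => <-; apply: le_measure; rewrite ?inE//.
- exact: measurable_cell.
- exact: measurableX.
- by move=> [x y] [].
Qed.

Let sum_row k : (\sum_(l <oo) pi (cell k l) = mu (S @^-1` P k))%E.
Proof.
rewrite -pi1// -(@nneseries_partition _ _ pi (fun l => setT `*` Q l)).
- by apply: eq_eseriesr => l _; rewrite -setXI setTI setIT.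
- by move=> l; exact: measurableX.
- apply/trivIsetP => i j _ _ ij; rewrite -setXI.
  by move/trivIsetP : tQ => /(_ i j I I ij) ->; rewrite setX0.
- by rewrite -setX_bigcupr cQ setXTT.
- exact: measurableX.
Qed.

Let sum_col l : (\sum_(k <oo) pi (cell k l) = nu (Q l))%E.
Proof.
rewrite -pi2// -(@nneseries_partition _ _ pi (fun k => P k `*` setT)).
- by apply: eq_eseriesr => k _; rewrite -setXI setTI setIT.
- by move=> k; exact: measurableX.
- apply/trivIsetP => i j _ _ ij; rewrite -setXI.
  by move/trivIsetP : tP => /(_ i j I I ij) ->; rewrite set0X.
- by rewrite -setX_bigcupl cP setXTT.
- exact: measurableX.
Qed.

(** The set [A x Q l] takes from the lifted cell the fraction [mu(A & S^-1 P k) / mu(S^-1 P k)] of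
    its mass [pi (cell k l)]. As the cells of row [k] have total mass [mu(S^-1 P k)], the row
    contributes [mu(A & S^-1 P k)]. *)
Lemma cell_coupling_fst A : measurable A -> cell_coupling (A `*` setT) = mu A.
Proof.
move=> mA; rewrite cell_couplingE -(nneseries_partition mu measurable_preimage_part tSP cSP mA).
apply: eq_eseriesr => k _.
transitivity (\sum_(l <oo)
    ((fine (mu (A `&` S @^-1` P k)) / fine (mu (S @^-1` P k)))%:E * pi (cell k l)))%E.
  apply: eq_eseriesr => l _.
  rewrite -setXI setTI prodE//; last by apply: measurableI => //; exact: measurable_preimage_part.
  rewrite piE.
  rewrite -!EFinM /cell_weight; congr EFin => /=.
  have [Q0|Q0] := eqVneq (fine (nu (Q l))) 0; first by rewrite pi_nu0// !mul0r mulr0.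
  have [P0|P0] := eqVneq (fine (mu (S @^-1` P k))) 0; first by rewrite pi_mu0// !mul0r mulr0.
  by field; rewrite P0 Q0.
rewrite nneseriesZl//.
rewrite sum_row muE -EFinM.
have [P0|P0] := eqVneq (fine (mu (S @^-1` P k))) 0; last first.
  rewrite divfK// fineK// fin_num_measure//; apply: measurableI => //.
  exact: measurable_preimage_part.
rewrite P0 mulr0; apply/esym/eqP; rewrite eq_le measure_ge0 andbT.
have -> : 0%:E = mu (S @^-1` P k) by rewrite muE P0.
apply: le_measure; rewrite ?inE//; try exact: measurable_preimage_part.
by apply: measurableI => //; exact: measurable_preimage_part.
Qed.

Lemma cell_coupling_snd A : measurable A -> cell_coupling (setT `*` A) = nu A.
Proof.
move=> mA; rewrite cell_couplingE -(nneseries_partition nu mQ tQ cQ mA).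
rewrite nneseries_interchange; last first.
  by move=> k l; rewrite mule_ge0 ?lee_fin ?cell_weight_ge0.
apply: eq_eseriesr => l _.
transitivity (\sum_(k <oo) ((fine (nu (A `&` Q l)) / fine (nu (Q l)))%:E * pi (cell k l)))%E.
  apply: eq_eseriesr => k _.
  rewrite -setXI setTI prodE//; [|exact: measurable_preimage_part|exact: measurableI].
  rewrite piE.
  rewrite -!EFinM /cell_weight; congr EFin => /=.
  have [Q0|Q0] := eqVneq (fine (nu (Q l))) 0; first by rewrite pi_nu0// !mul0r mulr0.
  have [P0|P0] := eqVneq (fine (mu (S @^-1` P k))) 0; first by rewrite pi_mu0// !mul0r mulr0.
  by field; rewrite P0 Q0.
rewrite nneseriesZl//.
rewrite sum_col nuE -EFinM.
have [Q0|Q0] := eqVneq (fine (nu (Q l))) 0; last first.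
  by rewrite divfK// fineK// fin_num_measure//; exact: measurableI.
rewrite Q0 mulr0; apply/esym/eqP; rewrite eq_le measure_ge0 andbT.
have -> : 0%:E = nu (Q l) by rewrite nuE Q0.
apply: le_measure; rewrite ?inE//.
exact: measurableI.
Qed.

Lemma cell_coupling_dominates : cell_coupling `<< (mu \x nu)%E.
Proof.
apply/null_content_dominatesP => A mA A0; rewrite cell_couplingE.
rewrite eseries0// => k _ _; rewrite eseries0// => l _ _.
rewrite (_ : (mu \x nu)%E _ = 0%E) ?mule0//.
by apply: subset_measure0 A0 => //; apply: measurableI => //; exact: measurable_lifted_cell.
Qed.

(** On a lifted cell [F] is below every value of [c] on the cell, hence below the [pi]-average of
    [c] there, and both couplings give the cell the same mass. *)
Lemma cell_coupling_cost (F : Z * Y -> R) (c : X * Y -> R) :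
  measurable_fun setT F -> (forall p, 0 <= F p) ->
  measurable_fun setT c -> (forall p, 0 <= c p) ->
  (forall k l p p', lifted_cell k l p -> cell k l p' -> F p <= c p') ->
  (\int[cell_coupling]_p (F p)%:E <= \int[pi]_p (c p)%:E)%E.
Proof.
move=> mF F0 mc c0 Fc.
have mF' : measurable_fun setT (EFin \o F) by exact/measurable_EFinP.
have mc' D : measurable_fun D (EFin \o c) by apply: measurable_funTS; exact/measurable_EFinP.
have F0' p : setT p -> (0 <= (EFin \o F) p)%E by rewrite /= lee_fin.
rewrite ge0_integral_measure_series//.
apply: (@le_trans _ _ (\sum_(k <oo) \sum_(l <oo) (\int[pi]_(p in cell k l) (c p)%:E)))%E; last first.
  have cells k : (\sum_(l <oo) \int[pi]_(p in cell k l) (c p)%:E =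
      \int[pi]_(p in P k `*` setT) (c p)%:E)%E.
    rewrite -cQ setX_bigcupr ge0_integral_bigcup//.
    - by move=> l; exact: measurable_cell.
    - by move=> *; rewrite lee_fin.
    - apply/trivIsetP => i j _ _ ij; rewrite -setXI.
      by move/trivIsetP : tQ => /(_ i j I I ij) ->; rewrite setX0.
  rewrite (eq_eseriesr (fun k _ => cells k)) -ge0_integral_bigcup//.
  - by rewrite -setX_bigcupl cP setXTT.
  - by move=> k; exact: measurableX.
  - by move=> *; rewrite lee_fin.
  - apply/trivIsetP => i j _ _ ij; rewrite -setXI.
    by move/trivIsetP : tP => /(_ i j I I ij) ->; rewrite set0X.
apply: lee_nneseries => [k _ _|k _]; first exact: integral_ge0.
rewrite ge0_integral_measure_series//.
apply: lee_nneseries => [l _ _|l _]; first exact: integral_ge0.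
have c0' : (0 <= \int[pi]_(p in cell k l) (c p)%:E)%E.
  by apply: integral_ge0 => p _; rewrite lee_fin.
have [W0|W0] := eqVneq (fine (pi (cell k l))) 0.
  rewrite ge0_integral_mscale//= /cell_weight W0 mul0r mul0e.
  exact: c0'.
(* The comparison with the average is stated as a product, since the integral of [c] may still be
   infinite. *)
have cpt p : lifted_cell k l p ->
    ((F p)%:E * pi (cell k l) <= \int[pi]_(p in cell k l) (c p)%:E)%E.
  move=> cp; rewrite -integral_cst//; last exact: measurable_cell.
  apply: ge0_le_integral => //.
  - exact: measurable_cell.
  - by move=> *; rewrite lee_fin.
  - by move=> p' cp'; rewrite lee_fin; exact: (Fc k l).
have [Ioo|Ioo] := eqVneq (\int[pi]_(p in cell k l) (c p)%:E)%E +oo%E.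
  by rewrite Ioo leey.
set I := (\int[pi]_(p in cell k l) (c p)%:E)%E in c0' cpt Ioo *.
have IE : I = (fine I)%:E by rewrite fineK// ge0_fin_numE// lt_neqAle Ioo leey.
have W1 : 0 < fine (pi (cell k l)) by rewrite lt_neqAle eq_sym W0 fine_ge0.
set w := fine (pi (cell k l)) in W0 W1 *.
have P1 : fine (mu (S @^-1` P k)) != 0 by apply: contra_neq W0; exact: pi_mu0.
have Q1 : fine (nu (Q l)) != 0 by apply: contra_neq W0; exact: pi_nu0.
apply: (@le_trans _ _ (\int[cell_measure k l]_p (cst (fine I / w)%:E p))%E).
  (* The bound on [F] holds only inside the lifted cell; its complement is null for
     [cell_measure k l]. *)
  apply: ae_ge0_le_integral => //.
    by move=> p _; rewrite /= lee_fin divr_ge0// ?fine_ge0// ltW.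
  exists (~` lifted_cell k l); split.
  - by apply: measurableC; exact: measurable_lifted_cell.
  - by rewrite /cell_measure/= /mscale/= /mrestr setICl measure0 mule0.
  - move=> p /=; apply: contra_not => cp _.
    by rewrite lee_fin ler_pdivlMr// -lee_fin EFinM -piE -IE; exact: cpt.
rewrite integral_cst//= /mscale/= /mrestr setTI prodE//; last exact: measurable_preimage_part.
rewrite IE -!EFinM lee_fin /cell_weight -/w le_eqVlt; apply/orP; left; apply/eqP.
by field; rewrite P1 Q1 W0.
Qed.

End discretize.

(** * Cubic grids and absolutely continuous lifts of couplings *)

Section grid.
Context {R : realType} (d : nat).
Local Notation X := 'cV[R]_d.

Definition grid_code (N : nat) (x : X) : {ffun 'I_d -> int} :=
  [ffun i => Num.floor (x i 0 * N.+1%:R)].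

(** Half-open cubes of side [1 / (N + 1)], enumerated through [pickle] to get a partition indexed by
    [nat]; a number that codes no cube gives the empty set. *)
Definition grid (N k : nat) : set X := [set x | pickle (grid_code N x) = k].

Lemma measurable_grid N k : measurable (grid N k).
Proof.
rewrite (_ : grid N k = if @pickle_inv {ffun 'I_d -> int} k is Some c then
    \bigcap_(i in [set: 'I_d]) (cV_coord i @^-1`
      `[(c i)%:~R / N.+1%:R, (c i + 1)%:~R / N.+1%:R[%classic)
  else set0).
  case: pickle_inv => // c; apply: fin_bigcap_measurable => // i _.
  by rewrite -[X in measurable X]setTI; apply: measurable_cV_coord.
have N0 : 0 < N.+1%:R :> R by [].
apply/seteqP; split => x.
  rewrite /grid/= => <-; rewrite pickleK_inv => i _ /=.
  rewrite in_itv/= ffunE /cV_coord ler_pdivrMr// ltr_pdivlMr//.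
  exact: real_floor_itv (num_real _).
have := @pickle_invK {ffun 'I_d -> int} k; case: pickle_inv => //= c ck H.
rewrite /grid/= -ck; congr pickle; apply/ffunP => i; rewrite ffunE.
apply/eqP; rewrite real_floor_eq ?num_real//.
have := H i I; rewrite /= in_itv/= /cV_coord.
by rewrite ler_pdivrMr// ltr_pdivlMr.
Qed.

Lemma trivIset_grid N : trivIset setT (grid N).
Proof. by move=> i j _ _ [x [<- <-]]. Qed.

Lemma bigcup_grid N : \bigcup_k grid N k = setT.
Proof. by apply/seteqP; split => // x _; exists (pickle (grid_code N x)). Qed.

Lemma grid_diameter N k (x y : X) i : grid N k x -> grid N k y ->
  `|x i 0 - y i 0| <= N.+1%:R^-1.
Proof.
rewrite /grid/= => <- /(pcan_inj pickleK_inv)/ffunP /(_ i); rewrite !ffunE.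
have N0 : 0 < N.+1%:R :> R by [].
have := real_floor_itv (num_real (x i 0 * N.+1%:R)).
have := real_floor_itv (num_real (y i 0 * N.+1%:R)).
move=> /andP[y1 y2] /andP[x1 x2] E; rewrite E in y1 y2.
rewrite -[leRHS]mul1r ler_pdivlMr// -[X in _ * X](gtr0_norm N0) -normrM mulrBl.
move: x1 x2 y1 y2; rewrite intrD => *.
by rewrite ler_norml; apply/andP; split; lra.
Qed.

(** In each coordinate [(a + r)^2 <= (1 + del) a^2 + (1 + 1 / del) r^2], with [|r| <= 2 / (N + 1)]
    because both points move within their cubes. *)
Lemma sqn_grid N k l (x x' y y' : X) (del : R) : 0 < del ->
  grid N k x -> grid N k x' -> grid N l y -> grid N l y' ->
  sqn (x - y) <= (1 + del) * sqn (x' - y') + (1 + del^-1) * (2 / N.+1%:R) ^+ 2 *+ d.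
Proof.
move=> del0 xk x'k yl y'l.
rewrite -[in X in _ *+ X](card_ord d) -sumr_const /sqn mulr_sumr -big_split/=.
apply: ler_sum => i _; rewrite !mxE.
set a := x' i 0 - y' i 0; set r := (x i 0 - x' i 0) - (y i 0 - y' i 0).
have -> : x i 0 - y i 0 = a + r by rewrite /a /r; ring.
set h := 2 / N.+1%:R.
have rh : r ^+ 2 <= h ^+ 2.
  rewrite -[leLHS]real_normK ?num_real// ler_sqr ?nnegrE// /h /r.
  have := grid_diameter i xk x'k; have := grid_diameter i yl y'l.
  move=> h1 h2; apply: (le_trans (ler_normB _ _)).
  by apply: (le_trans (lerD h2 h1)); rewrite mulr_natl -mulr2n.
  by rewrite divr_ge0.
have h1 : (1 + del^-1) * r ^+ 2 <= (1 + del^-1) * h ^+ 2.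
  by rewrite ler_wpM2l// addr_ge0// invr_ge0 ltW.
apply: le_trans (lerD (lexx _) h1).
have : 0 <= del^-1 * (del * a - r) ^+ 2 by rewrite mulr_ge0 ?sqr_ge0// invr_ge0 ltW.
have -> : del^-1 * (del * a - r) ^+ 2 = del * a ^+ 2 - 2 * a * r + del^-1 * r ^+ 2.
  by field; rewrite gt_eqF.
lra.
Qed.

(** The measure [gam] is the [cell_coupling] of a fine grid. It is dominated by the product measure,
    so that statements true for almost every pair of points pass to it. *)
Lemma lift_coupling (lam : probability X R) (S : X -> X) (mS : measurable_fun setT S)
    (nu : probability X R) (pi : probability (X * X)%type R) (eps : R) :
  coupling (pushforward lam S) nu pi -> 0 < eps ->
  exists gam : probability (X * X)%type R,
    [/\ coupling lam nu gam, gam `<< (lam \x nu)%E &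
      (\int[gam]_p (sqn (S p.1 - p.2))%:E <=
       \int[pi]_p (sqn (p.1 - p.2))%:E + eps%:E)%E].
Proof.
move=> cpi e0.
set J := (\int[pi]_p (sqn (p.1 - p.2))%:E)%E.
have J0 : (0 <= J)%E by apply: integral_ge0 => p _; rewrite lee_fin sqn_ge0.
(* For finite [J] the factor [1 + del] adds at most [eps / 2] to the cost; the grid term will add
   the other half. An infinite [J] has [fine J = 0], and the cost bound is then trivial. *)
pose del := eps / 2 / (fine J + 1).
have fJ0 : 0 <= fine J by exact: fine_ge0.
have del0 : 0 < del by rewrite !divr_gt0//; lra.
have [N HN] : exists N : nat, (1 + del^-1) * (2 / N.+1%:R) ^+ 2 *+ d <= eps / 2.
  pose M := (1 + del^-1) * 4 * d%:R.
  have M0 : 0 <= M by rewrite !mulr_ge0// addr_ge0// invr_ge0 ltW.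
  (* With [n = N + 1 > M / (eps / 2)], the grid term is [M / n^2 <= M / n < eps / 2]. *)
  exists (Num.truncn (M / (eps / 2))).
  have M1 : 0 <= M / (eps / 2) by apply: divr_ge0 => //; lra.
  have /andP[_] := truncn_itv M1; set n := (Num.truncn _).+1.
  rewrite ltr_pdivrMr ?divr_gt0//.
  move=> Mn; have n1 : 1 <= n%:R :> R by rewrite ler1n.
  have -> : (1 + del^-1) * (2 / n%:R) ^+ 2 *+ d = M / n%:R ^+ 2.
    by rewrite -mulr_natr /M; field; rewrite !gt_eqF//; lra.
  rewrite ler_pdivrMr; last by rewrite exprn_gt0//; lra.
  apply: (le_trans (ltW Mn)); rewrite mulrC ler_wpM2l//; first lra.
  by rewrite expr2 ler_peMr//; lra.
have pi1 A : measurable A -> pi (A `*` setT) = lam (S @^-1` A).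
  by move=> mA; have [-> _] := cpi A mA.
have pi2 A : measurable A -> pi (setT `*` A) = nu A.
  by move=> mA; have [_ ->] := cpi A mA.
pose G := grid N.
have mG := measurable_grid N.
have tG := @trivIset_grid N.
have cG := bigcup_grid N.
pose g := cell_coupling mS lam nu pi mG mG.
have gT : g setT = 1%E.
  rewrite -setXTT.
  have := cell_coupling_fst mS pi1 pi2 mG mG tG tG cG cG measurableT.
  by rewrite probability_setT.
pose gam : probability (X * X)%type R :=
  HB.pack g (Measure_isProbability.Build _ _ _ g gT).
exists gam; split.
- move=> A mA; split.
    exact: (cell_coupling_fst mS pi1 pi2 mG mG tG tG cG cG mA).
  exact: (cell_coupling_snd mS pi1 pi2 mG mG tG tG cG cG mA).
- exact: cell_coupling_dominates.
- have msub : measurable_fun setT (fun p : X * X => sqn (p.1 - p.2)).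
    by apply: measurable_sqn; apply: measurable_cVB; [exact: measurable_fst|exact: measurable_snd].
  have [Joo|Joo] := eqVneq J +oo%E; first by rewrite Joo leey.
  have JE : J = (fine J)%:E by rewrite fineK// ge0_fin_numE// lt_neqAle Joo leey.
  pose c (p : X * X) := (1 + del) * sqn (p.1 - p.2) + eps / 2.
  apply: (@le_trans _ _ (\int[pi]_p (c p)%:E)%E).
    apply: (@cell_coupling_cost _ _ _ _ _ _ _ S mS lam nu pi pi1 pi2 G G mG mG tG tG cG cG).
    + apply: measurable_sqn; apply: measurable_cVB; last exact: measurable_snd.
      by apply: measurableT_comp => //; exact: measurable_fst.
    + by move=> p; exact: sqn_ge0.
    + by apply: measurable_funD => //; apply: measurable_funM.
    + by move=> p; rewrite addr_ge0 ?divr_ge0 ?mulr_ge0 ?sqn_ge0//; lra.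
    + move=> k l [z y] [x y'] [/= zk yl] [/= xk y'l].
      apply: (le_trans (sqn_grid del0 zk xk yl y'l)).
      by rewrite /c lerD2l.
  rewrite /c.
  under eq_integral do rewrite EFinD EFinM.
  rewrite ge0_integralD//.
  + rewrite ge0_integralZl//.
    * rewrite integral_cst_prob -/J JE -EFinM -!EFinD lee_fin.
      have : del * fine J <= eps / 2.
        by rewrite /del mulrAC ler_pdivrMr ?ler_wpM2l//; lra.
      lra.
    * exact/measurable_EFinP.
    * by move=> p _; rewrite lee_fin sqn_ge0.
    * by rewrite lee_fin; lra.
  + by move=> p _; rewrite -EFinM lee_fin mulr_ge0 ?sqn_ge0//; lra.
  + by apply/measurable_EFinP; apply: measurable_funM.
  + by move=> p _; rewrite lee_fin; lra.
Qed.
End grid.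

(** * Projection on the tangent space *)

Section normal_equations.
Context {R : realType} (d : measure_display) (X : measurableType d) (lam : probability X R).

Definition mx_integrable p q (M : X -> 'M[R]_(p, q)) :=
  forall i j, lam.-integrable setT (EFin \o (fun z => M z i j)).

Definition mxRint p q (M : X -> 'M[R]_(p, q)) : 'M[R]_(p, q) :=
  \matrix_(i, j) \int[lam]_z M z i j.

Lemma Rintegral_linear_combination n (c : 'I_n -> R) (f : 'I_n -> X -> R) :
  (forall i, lam.-integrable setT (EFin \o f i)) ->
  lam.-integrable setT (EFin \o (fun z => \sum_i c i * f i z)) /\
  \int[lam]_z (\sum_i c i * f i z) = \sum_i c i * \int[lam]_z f i z.
Proof.
move=> fi; elim: (index_enum _) => [|i s [IH1 IH2]].
  have -> : (fun z : X => \sum_(i <- [::]) c i * f i z) = cst 0.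
    by apply/funext => z; rewrite big_nil.
  split; first exact: integrable0.
  by rewrite big_nil Rintegral_cst// mul0r.
have -> : (fun z : X => \sum_(i <- i :: s) c i * f i z) =
    (fun z => c i * f i z + \sum_(i <- s) c i * f i z).
  by apply/funext => z; rewrite big_cons.
have ci : lam.-integrable setT (EFin \o (fun z => c i * f i z)).
  exact: (integrableZl measurableT (c i) (fi i)).
split.
  exact: (integrableD measurableT ci IH1).
rewrite big_cons RintegralD// IH2; congr (_ + _).
by rewrite RintegralZl.
Qed.

Lemma mxRint_mull p q r (A : 'M[R]_(p, q)) (M : X -> 'M[R]_(q, r)) :
  mx_integrable M ->
  mx_integrable (fun z => A *m M z) /\ mxRint (fun z => A *m M z) = A *m mxRint M.
Proof.
move=> iM.
have H i j := Rintegral_linear_combination (A i) (fun k => iM k j).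
have E i j : (fun z => (A *m M z) i j) = (fun z => \sum_k A i k * M z k j).
  by apply/funext => z; rewrite mxE.
split=> [i j|]; first by rewrite E; exact: (H i j).1.
apply/matrixP => i j; rewrite !mxE E (H i j).2; apply: eq_bigr => k _.
by rewrite mxE.
Qed.

Lemma mxRint_mulr p q r (A : 'M[R]_(q, r)) (M : X -> 'M[R]_(p, q)) :
  mx_integrable M ->
  mx_integrable (fun z => M z *m A) /\ mxRint (fun z => M z *m A) = mxRint M *m A.
Proof.
move=> iM.
have H i j := Rintegral_linear_combination (A^~ j) (iM i).
have E i j : (fun z => (M z *m A) i j) = (fun z => \sum_k A k j * M z i k).
  by apply/funext => z; rewrite mxE; apply: eq_bigr => k _; rewrite mulrC.
split=> [i j|]; first by rewrite E; exact: (H i j).1.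
apply/matrixP => i j; rewrite !mxE E (H i j).2; apply: eq_bigr => k _.
by rewrite mxE mulrC.
Qed.

Lemma mxRintD p q (M N : X -> 'M[R]_(p, q)) :
  mx_integrable M -> mx_integrable N ->
  mx_integrable (fun z => M z + N z) /\
  mxRint (fun z => M z + N z) = mxRint M + mxRint N.
Proof.
move=> iM iN.
have E i j : (fun z => (M z + N z) i j) = (fun z => M z i j + N z i j).
  by apply/funext => z; rewrite mxE.
split=> [i j|]; first by rewrite E; exact: (integrableD measurableT (iM i j) (iN i j)).
by apply/matrixP => i j; rewrite !mxE E RintegralD.
Qed.

Lemma mx_integrable_mul p q r (M : X -> 'M[R]_(p, q)) (N : X -> 'M[R]_(q, r)) :
  (forall i j, (fun z => M z i j) \in Lfun lam 2%:E) ->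
  (forall i j, (fun z => N z i j) \in Lfun lam 2%:E) ->
  mx_integrable (fun z => M z *m N z).
Proof.
move=> iM iN i j.
have -> : (fun z => (M z *m N z) i j) = (fun z => \sum_k 1 * (M z i k * N z k j)).
  by apply/funext => z; rewrite mxE; apply: eq_bigr => k _; rewrite mul1r.
apply: (Rintegral_linear_combination _ _).1 => k; apply/Lfun1_integrable.
exact: Lfun2_mul_Lfun1.
Qed.

Lemma sqnE n (x : 'cV[R]_n) : sqn x = (x^T *m x) 0 0.
Proof. by rewrite mxE; apply: eq_bigr => i _; rewrite mxE expr2. Qed.

Context (p q : nat) (J : X -> 'M[R]_(p, q)) (V : X -> 'cV[R]_p).
Hypothesis J2 : forall i j, (fun z => J z i j) \in Lfun lam 2%:E.
Hypothesis V2 : forall i, (fun z => V z i 0) \in Lfun lam 2%:E.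

(** [G eta = b] is the system of normal equations for the approximation of [V] by [J eta] in L^2. *)
Let G := mxRint (fun z => (J z)^T *m J z).
Let b := mxRint (fun z => (J z)^T *m V z).

Let JT2 i j : (fun z => (J z)^T i j) \in Lfun lam 2%:E.
Proof. by rewrite (_ : (fun _ => _) = (fun z => J z j i))//; apply/funext => z; rewrite mxE. Qed.

Let V2' i j : (fun z => V z i j) \in Lfun lam 2%:E.
Proof. by rewrite ord1. Qed.

Let VT2 i j : (fun z => (V z)^T i j) \in Lfun lam 2%:E.
Proof. by rewrite (_ : (fun _ => _) = (fun z => V z j i))//; apply/funext => z; rewrite mxE. Qed.

Lemma residual_quadratic (eta : 'cV[R]_q) :
  mx_integrable (fun z => (V z - J z *m eta)^T *m (V z - J z *m eta)) /\
  mxRint (fun z => (V z - J z *m eta)^T *m (V z - J z *m eta)) =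
  mxRint (fun z => (V z)^T *m V z) - (eta^T *m b + b^T *m eta) + eta^T *m G *m eta.
Proof.
have trmxB m n (A B : 'M[R]_(m, n)) : (A - B)^T = A^T - B^T by apply/matrixP => i j; rewrite !mxE.
have E z : (V z - J z *m eta)^T *m (V z - J z *m eta) =
    (V z)^T *m V z + ((- eta^T) *m ((J z)^T *m V z) +
    (((V z)^T *m J z) *m (- eta) + eta^T *m (((J z)^T *m J z) *m eta))).
  rewrite trmxB mulmxBl !mulmxBr trmx_mul ?mulmxA ?mulNmx ?mulmxN ?mulmxA.
  move: ((V z)^T *m V z) (eta^T *m (J z)^T *m V z) ((V z)^T *m J z *m eta)
    (eta^T *m (J z)^T *m J z *m eta) => a1 a2 a3 a4.
  by apply/matrixP=> i j; rewrite !mxE; ring.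
have [i1 e1] := mxRint_mull (- eta^T) (mx_integrable_mul JT2 V2').
have [i2 e2] := mxRint_mulr (- eta) (mx_integrable_mul VT2 J2).
have [i3 e3] := mxRint_mulr eta (mx_integrable_mul JT2 J2).
have [i4 e4] := mxRint_mull eta^T i3.
have [i5 e5] := mxRintD i2 i4.
have [i6 e6] := mxRintD i1 i5.
have [i7 e7] := mxRintD (mx_integrable_mul VT2 V2') i6.
rewrite (funext E).
split => //; rewrite e7 e6 e5 e1 e2 e4 e3 -/G -/b.
rewrite mulmxN mulNmx -!addrA; congr (_ + _); rewrite opprD -!addrA; congr (_ + _).
congr (- _ + _); last by rewrite mulmxA.
congr (_ *m _); apply/matrixP => i j; rewrite !mxE; congr (Rintegral _ _ _).
apply/funext => z; rewrite !mxE; apply: eq_bigr => k _.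
by rewrite !mxE mulrC.
Qed.

Lemma gram_psd (eta : 'cV[R]_q) : 0 <= (eta^T *m G *m eta) 0 0.
Proof.
have [i3 e3] := mxRint_mulr eta (mx_integrable_mul JT2 J2).
have [i4 e4] := mxRint_mull eta^T i3.
rewrite -mulmxA -e3 -e4 mxE; apply: Rintegral_ge0 => z _.
by rewrite !mulmxA -mulmxA -trmx_mul -sqnE; apply: sumr_ge0 => i _; exact: sqr_ge0.
Qed.

(* [w := b - G (G^+ b)] is in the kernel of [G], so the nonnegative quadratic function of
   lemma [residual_quadratic] is affine along [w], hence constant: [w] is orthogonal to [b]. *)
Lemma normal_equation : G *m (mpinv G *m b) = b.
Proof.
have Gt : G^T = G.
  apply/matrixP => i j; rewrite !mxE; congr (Rintegral _ _ _).
  by apply/funext => z; rewrite !mxE; apply: eq_bigr => k _; rewrite !mxE mulrC.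
have [GBG BGB GBt BGt] := moore_penrose_mpinv G.
set B := mpinv G in GBG BGB GBt BGt *.
pose w := b - G *m (B *m b).
have Gw : G *m w = 0.
  (* Both [G] and [G B] are symmetric, so this is the transpose of [G B G = G]. *)
  have GGB : G *m (G *m B) = G by rewrite -{1}Gt -GBt -trmx_mul GBG Gt.
  by rewrite /w mulmxBr (mulmxA G B) (mulmxA G (G *m B)) GGB subrr.
have wb : (w^T *m b) 0 0 = 0.
  apply/eqP/negPn/negP => wb0.
  pose c := (mxRint (fun z => (V z)^T *m V z)) 0 0.
  (* With this [s] the integral of the squared residual at [s w] would be [c - (c + 1) = -1]. *)
  pose s := (c + 1) / (2 * (w^T *m b) 0 0).
  have [_] := residual_quadratic (s *: w).
  rewrite -[_ *m G *m _]mulmxA -[G *m _]scalemxAr Gw scaler0 mulmx0 addr0 => /matrixP /(_ 0 0).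
  rewrite [in RHS]mxE -/c [in RHS]mxE [X in _ - X]mxE => H.
  have : 0 <= (mxRint (fun z => (V z - J z *m (s *: w))^T *m (V z - J z *m (s *: w)))) 0 0.
    rewrite mxE; apply: Rintegral_ge0 => z _.
    by rewrite -sqnE; apply: sumr_ge0 => i _; exact: sqr_ge0.
  rewrite H.
  have -> : ((s *: w)^T *m b) 0 0 = s * (w^T *m b) 0 0.
    by rewrite linearZ/= -scalemxAl mxE.
  have -> : (b^T *m (s *: w)) 0 0 = s * (w^T *m b) 0 0.
    rewrite -scalemxAr mxE; congr (_ * _).
    by rewrite -[b^T *m w]trmxK trmx_mul trmxK mxE.
  have -> : s * (w^T *m b) 0 0 = (c + 1) / 2 by rewrite /s; field.
  by lra.
(* [|w|^2 = w^T b - w^T G (B b)], where both terms vanish. *)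
have w0 : w = 0.
  have : sqn w = 0.
    rewrite sqnE {2}/w mulmxBr mxE wb add0r mxE.
    have := congr1 trmx Gw; rewrite trmx_mul Gt trmx0 => wG.
    by rewrite (mulmxA w^T) wG mul0mx mxE oppr0.
  move/eqP; rewrite psumr_eq0 => [/allP H|i _]; last exact: sqr_ge0.
  apply/matrixP => i j; rewrite ord1 [RHS]mxE; apply/eqP.
  by have := H i; rewrite mem_index_enum sqrf_eq0 => /(_ isT).
by apply/esym/eqP; rewrite -subr_eq0; apply/eqP.
Qed.

(** With [xi = mpinv G b] and [G xi = b], the two sides differ by [(eta - xi)^T G (eta - xi)], which
    is nonnegative. *)
Lemma projection_minimizes (eta : 'cV[R]_q) :
  (\int[lam]_z (sqn (V z - J z *m (mpinv G *m b)))%:E <=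
   \int[lam]_z (sqn (V z - J z *m eta))%:E)%E.
Proof.
have I e : (\int[lam]_z (sqn (V z - J z *m e))%:E =
    ((mxRint (fun z => (V z - J z *m e)^T *m (V z - J z *m e))) 0 0)%:E)%E.
  have [i _] := residual_quadratic e.
  rewrite mxE /Rintegral fineK.
    by apply: eq_integral => z _; rewrite sqnE.
  exact: integrable_fin_num (i 0 0).
rewrite !I lee_fin !(residual_quadratic _).2.
set xi := mpinv G *m b.
have Gxi : G *m xi = b := normal_equation.
have := gram_psd (eta - xi).
have Gt : G^T = G.
  apply/matrixP => i j; rewrite !mxE; congr (Rintegral _ _ _).
  by apply/funext => z; rewrite !mxE; apply: eq_bigr => k _; rewrite !mxE mulrC.
have bG : b^T = xi^T *m G by rewrite -Gxi trmx_mul Gt.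
have trmxB m n (A B : 'M[R]_(m, n)) : (A - B)^T = A^T - B^T by apply/matrixP => i j; rewrite !mxE.
rewrite bG -Gxi trmxB !mulmxBl !mulmxBr !mulmxA.
move: (xi^T *m G *m xi) (eta^T *m G *m eta) (xi^T *m G *m eta) (eta^T *m G *m xi).
move: (mxRint _) => A1 A2 A3 A4 A5; rewrite !mxE; lra.
Qed.
End normal_equations.

(** * Derivatives along trajectories *)

Section one_sided.
Context {R : realType}.

(* Affine for negative times, so that the two-sided calculus applies at time 0. *)
Definition extend0 (V : normedModType R) (F : R -> V) (v0 : V) (t : R) : V :=
  if 0 <= t then F t else F 0 + t *: v0.

Lemma extend0E (V : normedModType R) (F : R -> V) v0 t : 0 <= t -> extend0 F v0 t = F t.
Proof. by rewrite /extend0 => ->. Qed.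

Lemma is_derive_cvg (V : normedModType R) (F : R -> V) (t : R) (v : V) :
  h^-1 *: (F (h *: 1 + t) - F t) @[h --> 0^'] --> v -> is_derive t 1 F v.
Proof.
move=> Fv; split; first by apply/cvg_ex; exists v.
exact: cvg_lim.
Qed.

Lemma is_derive_extend0 (V : normedModType R) (F : R -> V) (v0 v : V) (t : R) :
  0 <= t -> (t = 0 -> v = v0) -> has_deriv_ge0 F t v -> is_derive t 1 (extend0 F v0) v.
Proof.
move=> t0 vv0 Fv; apply: is_derive_cvg => A Av.
have := Fv A Av => -[e /= e0 He].
have [tE|tn0] := eqVneq t 0.
  exists e => //= h he h0; have [ht|ht] := leP 0 (t + h).
    have := He h he h0 ht.
    by rewrite /= [h *: 1]mulr1 [h + t]addrC (extend0E _ _ t0) (extend0E _ _ ht).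
  (* At time 0 a negative increment falls on the affine branch, where the difference quotient is
     exactly [v0]. *)
  rewrite tE add0r in ht.
  rewrite /= [h *: 1]mulr1 tE addr0 /extend0 lexx leNgt ht /= addrAC subrr add0r.
  rewrite scalerA mulVf// scale1r -(vv0 tE); exact: nbhs_singleton Av.
have {}t0 : 0 < t by rewrite lt_neqAle eq_sym tn0.
(* Increments smaller than [t] keep the time nonnegative, where the extension agrees with [F]. *)
exists (Num.min e t); first by rewrite /= lt_min e0.
move=> h /=; rewrite /ball_/= sub0r normrN lt_min => /andP[he ht] h0.
have ht0 : 0 <= t + h by move: ht; rewrite ltr_norml => /andP[]; lra.
have := He h; rewrite /= sub0r normrN => /(_ he h0 ht0).
by rewrite /= [h *: 1]mulr1 [h + t]addrC (extend0E _ _ (ltW t0)) (extend0E _ _ ht0).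
Qed.

Lemma has_deriv_ge0_coord n (F : R -> 'cV[R]_n) (t : R) (v : 'cV[R]_n) i :
  has_deriv_ge0 F t v -> has_deriv_ge0 (fun s => F s i 0 : R^o) t (v i 0).
Proof.
move=> Fv; rewrite /has_deriv_ge0.
have -> : (fun h => h^-1 *: (F (t + h) i 0 - F t i 0 : R^o)) =
    (fun M : 'cV[R]_n => M i 0 : R^o) \o (fun h => h^-1 *: (F (t + h) - F t)).
  by apply/funext => h /=; rewrite !mxE.
exact: (@cvg_comp _ _ _ _ _ _ _ _ Fv (@coord_continuous _ _ _ i 0 v)).
Qed.

Lemma has_deriv_ge0_cst (V : normedModType R) (c : V) (t : R) :
  has_deriv_ge0 (fun=> c) t 0.
Proof.
rewrite /has_deriv_ge0; under eq_fun do rewrite subrr scaler0.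
exact: cvg_cst.
Qed.

Lemma derive_along_curve m (f : 'cV[R]_m -> R) (g : R -> 'cV[R]_m) (t : R) (v : 'cV[R]_m) :
  is_derive t 1 g v -> differentiable f (g t) ->
  is_derive t 1 (f \o g) (\sum_j partial f j (g t) * v j 0).
Proof.
move=> [dg gv] df.
have {}dg : differentiable g t by exact/derivable1_diffP.
have dfg : differentiable (f \o g) t by exact: differentiable_comp.
split; first exact/derivable1_diffP.
rewrite deriveE// diff_comp//=.
have -> : 'd g t 1 = v by rewrite -deriveE.
rewrite [in LHS](matrix_sum_delta v) linear_sum; apply: eq_bigr => j _.
by rewrite big_ord1 linearZ/= /partial deriveE// mulrC.
Qed.

Lemma is_derive_sqdist n (a b a' b' : 'I_n -> R -> R) (t : R) :
  (forall i, is_derive t 1 (a i) (a' i t)) -> (forall i, is_derive t 1 (b i) (b' i t)) ->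
  is_derive t 1 (fun s => \sum_i (a i s - b i s) ^+ 2)
    (\sum_i 2 * ((a i t - b i t) * (a' i t - b' i t))).
Proof.
move=> da db.
have H i : is_derive t 1 (fun s => (a i s - b i s) ^+ 2)
    (2 * ((a i t - b i t) * (a' i t - b' i t))).
  have dai := da i; have dbi := db i.
  rewrite (_ : (fun s => (a i s - b i s) ^+ 2) = (a i - b i) ^+ 2) //.
  apply: is_derive_eq; rewrite /GRing.scale/= expr1.
  by rewrite -mulr_natl mulrA.
have := @is_derive_sum _ _ _ n (fun i s => (a i s - b i s) ^+ 2) t 1 _ H.
by rewrite fct_sumE.
Qed.

End one_sided.

(** * Null sets and laws *)

Section measure_facts.
Context {R : realType}.

(** The points [x] whose section of [B] is not [m2]-null form an [m1]-null set [U], and [phi] pulls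
    [U] back to an [l1]-null set. For every other [z] the section of the preimage is the preimage
    under [psi] of an [m2]-null set. *)
Lemma product_null dX dY dZ dW (X : measurableType dX) (Y : measurableType dY)
    (Z : measurableType dZ) (W : measurableType dW)
    (m1 : {sigma_finite_measure set X -> \bar R}) (m2 : {sigma_finite_measure set Y -> \bar R})
    (l1 : {sigma_finite_measure set Z -> \bar R}) (l2 : {sigma_finite_measure set W -> \bar R})
    (phi : Z -> X) (psi : W -> Y) (B : set (X * Y)) :
  measurable_fun setT phi -> measurable_fun setT psi ->
  pushforward l1 phi `<< m1 -> pushforward l2 psi `<< m2 ->
  measurable B -> (m1 \x m2)%E B = 0%E ->
  (l1 \x l2)%E [set p | B (phi p.1, psi p.2)] = 0%E.
Proof.
move=> mphi mpsi d1 d2 mB B0.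
have mx := measurable_fun_xsection m2 mB.
pose U := [set x | m2 (xsection B x) != 0%E].
have mU : measurable U.
  by rewrite -[U]setTI; exact: emeasurable_neq.
have U0 : m1 U = 0%E.
  have /((ae_eq_integral_abs m1 measurableT mx).1) [N [mN N0 UN]] :
      (\int[m1]_x `|(m2 \o xsection B) x| = 0)%E.
    by rewrite -[RHS]B0; apply: eq_integral => x _; rewrite gee0_abs.
  apply: (subset_measure0 mU mN _ N0) => x Ux; apply: UN => /= /(_ I) H.
  by move: Ux; rewrite /U/= H eqxx.
have := (null_content_dominatesP _ _).1 d1 _ mU U0; rewrite /pushforward => phiU0.
pose E := [set p : Z * W | B (phi p.1, psi p.2)].
have mE : measurable E.
  rewrite (_ : E = (fun p : Z * W => (phi p.1, psi p.2)) @^-1` B)//.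
  rewrite -[X in measurable X]setTI; apply: (_ : measurable_fun setT _) => //.
  apply/measurable_fun_pairP; split.
    exact: (measurableT_comp mphi measurable_fst).
  exact: (measurableT_comp mpsi measurable_snd).
have mphiU : measurable (phi @^-1` U) by rewrite -[X in measurable X]setTI; exact: mphi.
have mEx := measurable_fun_xsection l2 mE.
transitivity (\int[l1]_z `|(l2 \o xsection E) z|)%E.
  by apply: eq_integral => z _; rewrite gee0_abs.
apply/(ae_eq_integral_abs l1 measurableT mEx).
exists (phi @^-1` U); split => // z /= H; apply/eqP => Uz; apply: H => _ /=.
rewrite (_ : xsection E z = psi @^-1` (xsection B (phi z))); last first.
  by apply/seteqP; split => y /=; rewrite /xsection/= !inE.
exact: ((null_content_dominatesP _ _).1 d2 _ (measurable_xsection _ mB) Uz).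
Qed.

Import HBNNSimple.

(* [law p] is a bare set function, so [eq_measure_integral] does not apply to it. *)
Lemma eq_integral_set_function dT (T : measurableType dT) (mu nu : set T -> \bar R)
    (f : T -> \bar R) :
  (forall A, measurable A -> mu A = nu A) -> (\int[mu]_x f x = \int[nu]_x f x)%E.
Proof.
move=> munu.
have sE (h : {nnsfun T >-> R}) : sintegral mu h = sintegral nu h.
  by apply: eq_fsbigr => r _; congr (_ * _)%E; apply: munu; exact: measurable_sfunP.
rewrite /integral; congr (_ - _)%E; congr ereal_sup;
  by apply/seteqP; split => _ [h hf <-]; exists h.
Qed.

Lemma Lfun_measurable dT (T : measurableType dT) (mu : {measure set T -> \bar R}) (f : T -> R) p :
  f \in Lfun mu p -> measurable_fun setT f.
Proof. by rewrite inE => /andP[/[!inE]]. Qed.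

Lemma measure_eq_off_null d (T : measurableType d) (m : {measure set T -> \bar R})
    (A B N : set T) :
  measurable A -> measurable B -> measurable N -> m N = 0%E ->
  A `\` N = B `\` N -> m A = m B.
Proof.
move=> mA mB mN N0 AB.
have H E : measurable E -> m E = m (E `\` N).
  move=> mE; rewrite (measureDI m mE mN) [X in (_ + X)%E](_ : _ = 0%E) ?adde0//.
  by apply: (subset_measure0 _ mN _ N0) => //; exact: measurableI.
by rewrite H// [RHS]H// AB.
Qed.

Context (d : nat).
Local Notation X := 'cV[R]_d.
Local Notation leb := (lebesgue_cV R d).

Lemma law_dominates (p : X -> R) : prob_density p -> law p `<< leb.
Proof.
move=> [mp p0 _]; apply/null_content_dominatesP => A mA A0; rewrite /law.
transitivity (\int[leb]_(x in A) `|(p x)%:E|)%E.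
  by apply: eq_integral => z _; rewrite /= ger0_norm.
by apply: integral_abs_eq0 => //; apply/measurable_EFinP; exact: measurable_funTS.
Qed.

Lemma dominates_law (lam : {measure set X -> \bar R}) (p : X -> R) :
  prob_density p -> (forall x, 0 < p x) ->
  (forall A, measurable A -> lam A = law p A) -> leb `<< lam.
Proof.
move=> [mp p0 _] pgt0 lamE.
apply/null_content_dominatesP => A mA lA0.
have I0 : law p A = 0%E by rewrite -lamE.
have := ae_eq_integral_abs leb mA (f := EFin \o p).
move=> /(_ _)[|H _]; first by apply/measurable_EFinP; exact: measurable_funTS.
have /H [N [mN N0 AN]] : (\int[leb]_(z in A) `|(EFin \o p) z| = 0)%E.
  by rewrite -[RHS]I0; apply: eq_integral => z _; rewrite /= ger0_norm.
apply: (subset_measure0 mA mN _ N0) => z Az; apply: AN => /= /(_ Az) [].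
by move=> pz; have := pgt0 z; rewrite pz ltxx.
Qed.

(** This admits [shift_on B h] as a test map in the Lipschitz hypothesis. The preimage of a null set
    [A] lies in the union of [A] and [A - h], and [|z + h|^2 <= 2 |z|^2 + 2 |h|^2]. *)
Lemma pushforward_shift_on (lam : probability X R) (B : set X) (h : X) :
  lam `<< leb -> (\int[lam]_z (sqn z)%:E < +oo)%E -> measurable B ->
  pushforward_map lam (shift_on B h).
Proof.
move=> lamleb mom mB.
have mj := measurable_shift_on h mB.
split => //.
  apply/null_content_dominatesP => A mA A0; rewrite /pushforward.
  have mA' : measurable ((fun x => x + h) @^-1` A).
    by rewrite -[X in measurable X]setTI; exact: measurable_cV_shift.
  have lA : lam A = 0%E by exact: ((null_content_dominatesP _ _).1 lamleb _ mA A0).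
  have lA' : lam ((fun x => x + h) @^-1` A) = 0%E.
    apply: ((null_content_dominatesP _ _).1 lamleb) => //.
    by rewrite -[RHS]A0; exact: lebesgue_cV_shift.
  have mjA : measurable (shift_on B h @^-1` A) by rewrite -[X in measurable X]setTI; exact: mj.
  apply: (@subset_measure0 _ _ _ lam _ (A `|` ((fun x => x + h) @^-1` A)) mjA).
  - exact: measurableU.
  - move=> z; rewrite /shift_on /= indicE.
    case: (z \in B); rewrite ?scale1r ?scale0r ?addr0; by [right|left].
  - apply/eqP; rewrite eq_le measure_ge0 andbT.
    have <- : (lam A + lam ((fun x => (x + h)%R) @^-1` A) = 0)%E by rewrite lA lA' adde0.
    exact: (@measureU2 _ _ _ lam _ _ mA mA').
rewrite /second_moment (ge0_integral_pushforward mj)//; last 2 first.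
- by apply/measurable_EFinP; apply: measurable_sqn; exact: measurable_id.
- by move=> *; rewrite lee_fin sqn_ge0.
rewrite preimage_setT.
apply: (@le_lt_trans _ _ (\int[lam]_z (2%:E * (sqn z)%:E + (2 * sqn h)%:E))%E).
  have ms : measurable_fun setT (fun z : X => (sqn z)%:E).
    by apply/measurable_EFinP; apply: measurable_sqn; exact: measurable_id.
  apply: ge0_le_integral => //.
  - by move=> z _; rewrite lee_fin sqn_ge0.
  - by apply/measurable_EFinP; exact: measurable_sqn.
  - by apply: emeasurable_funD => //; apply: emeasurable_funM.
  - move=> z _ /=; rewrite -EFinM -EFinD lee_fin /shift_on.
    apply: (le_trans (sqnD_le _ _)); rewrite lerD2l ler_wpM2l// indicE.
    by case: (z \in B); rewrite ?scale1r// scale0r sqn0 sqn_ge0.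
have ms : measurable_fun setT (fun z : X => (sqn z)%:E).
  by apply/measurable_EFinP; apply: measurable_sqn; exact: measurable_id.
rewrite ge0_integralD//.
- rewrite ge0_integralZl//; last by move=> *; rewrite lee_fin sqn_ge0.
  rewrite integral_cst_prob lte_add_pinfty ?ltry//.
  by rewrite lte_mul_pinfty.
- by move=> z _; rewrite -EFinM lee_fin mulr_ge0 ?sqn_ge0.
- by apply: emeasurable_funM.
- by move=> *; rewrite lee_fin mulr_ge0 ?sqn_ge0.
Qed.

(** The joint law of [phi] and [psi] under [gam] is a coupling of [mu] and [nu]. *)
Lemma W2sq_le dO (Om : measurableType dO) (gam : probability Om R) (phi psi : Om -> X)
    (mu nu : set X -> \bar R) :
  measurable_fun setT phi -> measurable_fun setT psi ->
  (forall A, measurable A -> gam (phi @^-1` A) = mu A) ->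
  (forall A, measurable A -> gam (psi @^-1` A) = nu A) ->
  (W2sq mu nu <= \int[gam]_w (sqn (phi w - psi w))%:E)%E.
Proof.
move=> mphi mpsi Emu Enu.
pose f w := (phi w, psi w).
have mf : measurable_fun setT f by apply/measurable_fun_pairP; split.
pose Y : {mfun Om >-> (X * X)%type} := HB.pack f (isMeasurableFun.Build _ _ _ _ f mf).
apply: ereal_inf_lbound; exists (distribution gam Y).
  by move=> A mA; rewrite -Emu// -Enu//; split; congr (gam _); apply/seteqP; split=> w //= [].
rewrite /distribution (ge0_integral_pushforward mf)//.
- apply/measurable_EFinP; apply: measurable_sqn.
  by apply: measurable_cVB; [exact: measurable_fst|exact: measurable_snd].
- by move=> *; rewrite lee_fin sqn_ge0.
Qed.

Lemma ae_off_null2 dT (T : measurableType dT) (mu : {measure set T -> \bar R}) (A B : set T)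
    (P : T -> Prop) : measurable A -> measurable B -> mu A = 0%E -> mu B = 0%E ->
  (forall x, ~ A x -> ~ B x -> P x) -> {ae mu, forall x, P x}.
Proof.
move=> mA mB A0 B0 AB.
have nA : {ae mu, forall x, ~ A x} by exists A; split => // x /= /contrapT.
have nB : {ae mu, forall x, ~ B x} by exists B; split => // x /= /contrapT.
by apply: filterS2 nA nB => x; exact: AB.
Qed.

End measure_facts.

(** * Growth of the coupled distance *)

Section characteristic_coupling.
Context {R : realType} (d : nat).
Local Notation X := 'cV[R]_d.
Local Notation leb := (lebesgue_cV R d).
Context (Pi : 'I_d -> X -> R) (sigma : 'I_d -> R) (rho : X -> R -> R) (lam : probability X R).
Hypothesis rho_density : forall t : R, 0 <= t -> prob_density (rho^~ t).
Hypothesis rho_moment : forall t : R, 0 <= t -> (second_moment (law (rho^~ t)) < +oo)%E.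
Hypothesis rho_gt0 : forall (t : R) x, 0 <= t -> 0 < rho x t.
Hypothesis lamE : forall A, measurable A -> lam A = law (rho^~ 0) A.
Hypothesis velocity_L2 : forall S, pushforward_map lam S -> forall t : R, 0 <= t ->
    forall i, (fun z => velocity Pi sigma rho (S z) t i 0) \in Lfun lam 2%:E.
Context (C : R).
Hypothesis C_gt0 : 0 < C.
Hypothesis velocity_lip : velocity_lipschitz Pi sigma rho lam C.
Local Notation vel := (velocity Pi sigma rho).

Let lam_leb : lam `<< leb.
Proof.
apply/null_content_dominatesP => A mA A0.
have := (null_content_dominatesP _ _).1 (law_dominates (rho_density (lexx 0))) A mA A0.
by rewrite -lamE.
Qed.

Let lam_moment : (\int[lam]_z (sqn z)%:E < +oo)%E.
Proof.
rewrite (_ : (\int[lam]_z _ = second_moment (law (rho^~ 0%R)))%E); first exact: rho_moment.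
exact: eq_integral_set_function.
Qed.

Let push_id : pushforward_map lam id.
Proof.
split; first exact: measurable_id.
- exact: lam_leb.
- exact: lam_moment.
Qed.

(** Square-integrability along the identity map includes measurability. *)
Lemma measurable_velocity (t : R) : 0 <= t -> measurable_fun setT (fun x => vel x t).
Proof.
move=> t0; apply/measurable_fun_cVP => i.
exact: Lfun_measurable (velocity_L2 push_id t0 i).
Qed.

Lemma velocity_ae_lipschitz (t : R) : 0 <= t ->
  (leb \x leb)%E [set xy | C * sqn (xy.1 - xy.2) < sqn (vel xy.1 t - vel xy.2 t)] = 0%E.
Proof.
move=> t0; apply: (ae_lipschitz C_gt0 (lam := lam) (v := fun x => vel x t)).
- exact: (dominates_law (rho_density (lexx 0)) (fun x => rho_gt0 x (lexx 0)) lamE).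
- exact: measurable_velocity.
- move=> h B mB.
  exact: (velocity_lip push_id (pushforward_shift_on h lam_leb lam_moment mB) t0).
Qed.

(** The growth estimate needs a derivative for every starting point. Trajectories starting in the
    exceptional null set [N] are therefore frozen at their starting point, with derivative 0, which
    does not change the laws. *)
Lemma regular_flow (x : R -> X -> X) : solution_flow Pi sigma rho lam x ->
  exists y w : R -> X -> X, exists N : set X,
    [/\ (forall t : R, 0 <= t -> measurable_fun setT (y t)),
        (forall z, y 0 z = z),
        (forall z (t : R), 0 <= t -> has_deriv_ge0 (y^~ z) t (w t z)),
        [/\ measurable N, lam N = 0%E &
           forall z, ~ N z -> forall t : R, 0 <= t -> w t z = vel (y t z) t] &
        (forall t : R, 0 <= t -> forall A, measurable A ->
          lam (y t @^-1` A) = law (rho^~ t) A)].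
Proof.
move=> [mx [N [mN N0 NP]] lawx].
have good z : ~ N z -> x 0 z = z /\
    forall t : R, 0 <= t -> has_deriv_ge0 (x^~ z) t (vel (x t z) t).
  by move=> Nz; apply/not_notP => nP; apply: Nz; apply: NP.
pose y t z := if z \in N then z else x t z.
pose w t z := if z \in N then 0 else vel (x t z) t.
have my (t : R) : 0 <= t -> measurable_fun setT (y t).
  move=> t0; apply/measurable_fun_cVP => i.
  rewrite (_ : (fun z => y t z i 0) = (fun z => \1_N z * z i 0 + \1_(~` N) z * x t z i 0)).
    apply: measurable_funD; apply: measurable_funM.
    - exact: measurable_indic.
    - exact: (measurable_cV_coord i).
    - by apply: measurable_indic; exact: measurableC.
    - by have /measurable_fun_cVP := mx t t0; exact.
  apply/funext => z; rewrite /y !indicE in_setC.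
  by case: (z \in N); rewrite /= ?mul1r ?mul0r ?addr0 ?add0r.
exists y, w, N; split; first exact: my.
- move=> z; rewrite /y; case: ifPn => // /negP zN; apply: (good z _).1.
  by move=> Nz; apply: zN; rewrite inE.
- move=> z t t0; rewrite /y /w; case: ifPn => zN; first exact: has_deriv_ge0_cst.
  by apply: (good z _).2 => //; move/negP : zN => zN Nz; apply: zN; rewrite inE.
- split; [exact: mN|exact: N0|move=> z Nz t t0].
  have zN : (z \in N) = false by apply/negP; rewrite inE.
  by rewrite /w /y zN.
- move=> t t0 A mA; rewrite -(lawx t t0 A mA).
  apply: (@measure_eq_off_null _ _ _ lam _ _ N) => //.
  + by rewrite -[X in measurable X]setTI; exact: my.
  + by rewrite -[X in measurable X]setTI; exact: mx.
  + apply/seteqP; split => z [/= + Nz]; rewrite /y memNset//.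
Qed.

Context (m : nat) (Theta : set 'cV[R]_m) (T : 'cV[R]_m -> X -> X).
Hypothesis T_push : forall th, Theta th -> pushforward_map lam (T th).
Hypothesis T_C1 : C1_family Theta T.
Hypothesis jac_L2 : forall th, Theta th -> forall i j,
    (fun z => jac T th z i j) \in Lfun lam 2%:E.
Local Notation delta := (projection_error Pi sigma rho lam Theta T).

(** The projected velocity solves the normal equations, so its residual is below that of every [xi],
    hence below the infimum, and this infimum is one of those whose supremum is [delta]. *)
Lemma projection_bound th (s : R) : Theta th -> 0 <= s ->
  (\int[lam]_z (sqn (vel (T th z) s -
     jac T th z *m projected_velocity Pi sigma rho lam T th s))%:E <= delta)%E.
Proof.
move=> Tth s0.
apply: (@le_trans _ _ (ereal_inf [set
      (\int[lam]_z (sqn (vel (T th z) s - jac T th z *m xi))%:E)%E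
    | xi in [set: 'cV[R]_m]])); last first.
  apply: (@le_trans _ _ (ereal_sup [set ereal_inf [set
      (\int[lam]_z (sqn (vel (T th' z) s - jac T th' z *m xi))%:E)%E
    | xi in [set: 'cV[R]_m]] | th' in Theta])).
    by apply: ereal_sup_ubound; exists th.
  by apply: ereal_sup_ubound; exists s.
apply: le_ereal_inf_tmp => _ [xi _ <-].
have E : projected_velocity Pi sigma rho lam T th s =
    mpinv (mxRint lam (fun z => (jac T th z)^T *m jac T th z)) *m
    mxRint lam (fun z => (jac T th z)^T *m vel (T th z) s).
  rewrite /projected_velocity; congr (_ *m _).
  by apply/matrixP => i j; rewrite !mxE ord1.
rewrite E; exact: projection_minimizes (jac_L2 Tth) (velocity_L2 (T_push Tth) s0) xi.
Qed.

Context (theta dtheta : R -> 'cV[R]_m).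
Hypothesis theta_Theta : forall t : R, 0 <= t -> Theta (theta t).
Hypothesis theta_deriv : forall t : R, 0 <= t -> has_deriv_ge0 theta t (dtheta t).
Hypothesis theta_ode : forall t : R, 0 <= t ->
    dtheta t = projected_velocity Pi sigma rho lam T (theta t) t.

(** This is [expected_growth] with rate [1 + 2 C] for the squared distance [e] between the two
    trajectories of a pair of labels, [al] being the squared residual of the projection. *)
Lemma coupled_growth (y w : R -> X -> X) (N : set X) (gam : probability (X * X)%type R) (t : R) :
  (forall t : R, 0 <= t -> measurable_fun setT (y t)) ->
  (forall z, y 0 z = z) ->
  (forall z (t : R), 0 <= t -> has_deriv_ge0 (y^~ z) t (w t z)) ->
  measurable N -> lam N = 0%E ->
  (forall z, ~ N z -> forall t : R, 0 <= t -> w t z = vel (y t z) t) ->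
  (forall t : R, 0 <= t -> forall A, measurable A ->
    lam (y t @^-1` A) = law (rho^~ t) A) ->
  coupling lam lam gam -> gam `<< (lam \x lam)%E -> 0 <= t ->
  (\int[gam]_p (sqn (T (theta t) p.1 - y t p.2))%:E <=
   (expR ((1 + 2 * C) * t))%:E * \int[gam]_p (sqn (T (theta 0) p.1 - p.2))%:E +
   (2 / (1 + 2 * C) * (expR ((1 + 2 * C) * t) - 1))%:E * delta)%E.
Proof.
move=> my y0 dy mN N0 wE lawy cgam dgam t0.
pose thx := extend0 theta (dtheta 0).
pose a (z : X) i (s : R) := T (thx s) z i 0.
pose a' (z : X) i (s : R) := (jac T (theta s) z *m dtheta s) i 0.
pose b (z : X) i := extend0 (fun s => y s z i 0 : R^o) (w 0 z i 0).
pose b' (z : X) i (s : R) := w s z i 0.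
pose e (s : R) (p : X * X) := \sum_i (a p.1 i s - b p.2 i s) ^+ 2.
pose e' (s : R) (p : X * X) := \sum_i 2 * ((a p.1 i s - b p.2 i s) * (a' p.1 i s - b' p.2 i s)).
have aE z i s : 0 <= s -> a z i s = T (theta s) z i 0.
  by move=> s0; rewrite /a /thx extend0E.
have bE z i s : 0 <= s -> b z i s = y s z i 0.
  by move=> s0; rewrite /b extend0E.
have eE s p : 0 <= s -> e s p = sqn (T (theta s) p.1 - y s p.2).
  by move=> s0; apply: eq_bigr => i _; rewrite aE// bE// !mxE.
have da z i (s : R) : 0 <= s -> is_derive s 1 (a z i) (a' z i s).
  move=> s0.
  have dth : is_derive s 1 thx (dtheta s).
    by apply: is_derive_extend0 => //; [move=> ->|exact: theta_deriv].
  have dT : differentiable (fun th => T th z i 0) (thx s).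
    have := (T_C1 z).1 (theta s) (theta_Theta s0).
    rewrite -(extend0E theta (dtheta 0) s0) => dTz.
    apply: (@differentiable_comp _ _ _ _ (T^~ z) (fun M : 'cV[R]_d => M i 0)) => //.
    exact: differentiable_coord.
  have := derive_along_curve dth dT.
  rewrite (_ : \sum_j _ = a' z i s)//.
  by rewrite /a' mxE; apply: eq_bigr => j _; rewrite mxE /thx extend0E.
have db z i (s : R) : 0 <= s -> is_derive s 1 (b z i) (b' z i s).
  move=> s0; apply: is_derive_extend0 => //; first by move=> ->.
  exact: (@has_deriv_ge0_coord R d (y^~ z) s (w s z) i (dy z s s0)).
have de (s : R) p : 0 <= s -> is_derive s 1 (e^~ p) (e' s p).
  by move=> s0; apply: is_derive_sqdist => i; [exact: da|exact: db].
have mT s : 0 <= s -> measurable_fun setT (T (theta s)).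
  by move=> s0; have [] := T_push (theta_Theta s0).
have mTy s : 0 <= s -> measurable_fun setT (fun p : X * X => T (theta s) p.1 - y s p.2).
  move=> s0; apply: measurable_cVB.
    exact: (measurableT_comp (mT s s0) measurable_fst).
  exact: (measurableT_comp (my s s0) measurable_snd).
have me (s : R) : 0 <= s -> measurable_fun setT (e s).
  move=> s0; rewrite (_ : e s = (fun p => sqn (T (theta s) p.1 - y s p.2))).
    by apply: measurable_sqn; exact: mTy.
  by apply/funext => p; exact: eE.
have K0 : 0 < 1 + 2 * C by rewrite ltr_wpDr// mulr_ge0// ltW.
have e0 s p : 0 <= e s p by apply: sumr_ge0 => i _; exact: sqr_ge0.
have := @expected_growth _ _ _ gam e e' (1 + 2 * C) delta t K0 t0 e0 me de.
rewrite (_ : (\int[gam]_w _ = \int[gam]_p (sqn (T (theta t) p.1 - y t p.2))%:E)%E); last first.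
  by apply: eq_integral => p _; rewrite eE.
rewrite (_ : (\int[gam]_w (e 0 w)%:E = \int[gam]_p (sqn (T (theta 0) p.1 - p.2))%:E)%E); last first.
  by apply: eq_integral => p _; rewrite eE// y0.
apply => s s0.
pose al z := sqn (vel (T (theta s) z) s - jac T (theta s) z *m dtheta s).
have mal : measurable_fun setT al.
  apply: measurable_sqn; apply: measurable_cVB.
    exact: (measurableT_comp (measurable_velocity s0) (mT s s0)).
  apply/measurable_fun_cVP => i; under eq_fun do rewrite mxE.
  apply: measurable_sum => j; apply: measurable_funM => //.
  exact: Lfun_measurable (jac_L2 (theta_Theta s0) i j).
exists (fun p => al p.1); split.
- exact: (measurableT_comp mal measurable_fst).
- by move=> p; exact: sqn_ge0.
- pose B := [set xy : X * X | C * sqn (xy.1 - xy.2) < sqn (vel xy.1 s - vel xy.2 s)].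
  have mv := measurable_velocity s0.
  have mB : measurable B.
    pose G (xy : X * X) := sqn (vel xy.1 s - vel xy.2 s) - C * sqn (xy.1 - xy.2).
    have mG : measurable_fun setT G.
      apply: measurable_funB.
        apply/measurable_sqn/measurable_cVB.
          exact: (measurableT_comp mv measurable_fst).
        exact: (measurableT_comp mv measurable_snd).
      apply: measurable_funM => //; apply/measurable_sqn/measurable_cVB.
        exact: measurable_fst.
      exact: measurable_snd.
    rewrite (_ : B = G @^-1` `]0, +oo[).
      by rewrite -[X in measurable X]setTI; exact: mG.
    by apply/seteqP; split => x /=; rewrite in_itv/= andbT subr_gt0.
  pose B' := [set p : X * X | B (T (theta s) p.1, y s p.2)].
  have mB' : measurable B'.
    have -> : B' = (fun p : X * X => (T (theta s) p.1, y s p.2)) @^-1` B by reflexivity.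
    rewrite -[X in measurable X]setTI; apply: (_ : measurable_fun setT _) => //.
    apply/measurable_fun_pairP; split.
      exact: (measurableT_comp (mT s s0) measurable_fst).
    exact: (measurableT_comp (my s s0) measurable_snd).
  (* Both position maps have absolutely continuous laws, so the null set of bad pairs of positions
     pulls back to a [lam \x lam]-null set of labels, which [gam] does not charge. *)
  have gB' : gam B' = 0%E.
    apply: ((null_content_dominatesP _ _).1 dgam _ mB').
    have push_T : pushforward lam (T (theta s)) `<< leb by have [] := T_push (theta_Theta s0).
    have push_y : pushforward lam (y s) `<< leb.
      apply/null_content_dominatesP => A mA A0; rewrite /pushforward lawy//.
      exact: ((null_content_dominatesP _ _).1 (law_dominates (rho_density s0)) A mA A0).
    exact: (product_null (mT s s0) (my s s0) push_T push_y mB (velocity_ae_lipschitz s0)).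
  have gN : gam (setT `*` N) = 0%E by rewrite (cgam N mN).2.
  have mTN : measurable (setT `*` N : set (X * X)) by exact: measurableX.
  apply: (ae_off_null2 mB' mTN gB' gN) => p nB nN.
  have {}nN : ~ N p.2 by move=> Np; apply: nN.
  have {}nB : sqn (vel (T (theta s) p.1) s - vel (y s p.2) s) <=
      C * sqn (T (theta s) p.1 - y s p.2).
    by rewrite leNgt; apply/negP => h; exact: nB.
  rewrite -(eE s p s0) in nB.
  (* Coordinatewise, [2 c (u - v2) <= c^2 + (u - v2)^2 <= c^2 + 2 (v1 - u)^2 + 2 (v1 - v2)^2]. The
     last square is then absorbed through [nB], which turns the rate 1 into [1 + 2 C]. *)
  have : e' s p <= e s p + (2 * al p.1 + 2 * sqn (vel (T (theta s) p.1) s - vel (y s p.2) s)).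
    rewrite /e' /e /al /sqn !mulr_sumr -!big_split/=; apply: ler_sum => i _.
    rewrite /b' wE// /a'; set c := a _ _ _ - _.
    move: (vel (T (theta s) p.1) s) (vel (y s p.2) s) (jac T (theta s) p.1 *m dtheta s) => V1 V2 U.
    rewrite !mxE; move: (V1 i 0) (V2 i 0) (U i 0) => v1 v2 u.
    have := sqr_ge0 (c - (u - v2)); have := sqr_ge0 ((v1 - u) + (v1 - v2)).
    nra.
  move=> /le_trans; apply; lra.
- apply: le_trans (projection_bound (theta_Theta s0) s0).
  rewrite -theta_ode//.
  (* [al] depends on the first label only, whose law under [gam] is [lam]. *)
  have -> : (\int[gam]_w (al w.1)%:E = \int[pushforward gam fst]_z (al z)%:E)%E.
    rewrite (ge0_integral_pushforward measurable_fst)//.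
    - exact/measurable_EFinP.
    - by move=> *; rewrite lee_fin sqn_ge0.
  rewrite le_eqVlt; apply/orP; left; apply/eqP.
  apply: eq_measure_integral => A mA _.
  transitivity (gam (A `*` setT)); last exact: (cgam A mA).1.
  transitivity (gam (fst @^-1` A)); first by [].
  by congr (gam _); apply/seteqP; split => q //= [].
Qed.

End characteristic_coupling.


(** * Passage to the infimum over couplings of the initial laws *)

Theorem theorem3 (R : realType) (d m : nat) (d_gt0 : (0 < d)%N)
  (m_gt0 : (0 < m)%N)
  (* payoffs, noise levels, density *)
  (Pi : 'I_d -> 'cV[R]_d -> R) (sigma : 'I_d -> R) (rho : 'cV[R]_d -> R -> R)
  (Pi_C1 : forall i, C1 (Pi i))
  (rho_density : forall t : R, 0 <= t -> prob_density (rho^~ t))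
  (rho_moment : forall t : R, 0 <= t -> (second_moment (law (rho^~ t)) < +oo)%E)
  (rho_gt0 : forall (t : R) x, 0 <= t -> 0 < rho x t)
  (rho_score : forall (t : R) x i, 0 <= t -> has_partial (fun y => ln (rho y t)) i x)
  (rho_FP : fokker_planck Pi sigma rho)
  (* reference measure and characteristic flow *)
  (lam : probability 'cV[R]_d R)
  (lamE : forall A, measurable A -> lam A = law (rho^~ 0) A)
  (flow : exists x : R -> 'cV[R]_d -> 'cV[R]_d,
    solution_flow Pi sigma rho lam x)
  (velocity_L2 : forall S, pushforward_map lam S -> forall t : R, 0 <= t ->
    forall i, (fun z => velocity Pi sigma rho (S z) t i 0) \in Lfun lam 2%:E)
  (C : R) (C_gt0 : 0 < C)
  (velocity_lip : velocity_lipschitz Pi sigma rho lam C)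
  (* parameterized family *)
  (Theta : set 'cV[R]_m) (T : 'cV[R]_m -> 'cV[R]_d -> 'cV[R]_d)
  (T_push : forall th, Theta th -> pushforward_map lam (T th))
  (T_C1 : C1_family Theta T)
  (jac_L2 : forall th, Theta th -> forall i j,
    (fun z => jac T th z i j) \in Lfun lam 2%:E)
  (* parameter dynamics *)
  (theta dtheta : R -> 'cV[R]_m)
  (theta_Theta : forall t : R, 0 <= t -> Theta (theta t))
  (theta_deriv : forall t : R, 0 <= t -> has_deriv_ge0 theta t (dtheta t))
  (theta_C1 : {within [set t : R | 0 <= t], continuous dtheta})
  (theta_ode : forall t : R, 0 <= t ->
    dtheta t = projected_velocity Pi sigma rho lam T (theta t) t)
  (* local boundedness of second moments *)
  (rho_bound : forall a : R, exists M : R, forall t : R, 0 <= t <= a ->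
    (second_moment (law (rho^~ t)) <= M%:E)%E)
  (theta_bound : forall a : R, exists M : R, forall t : R, 0 <= t <= a ->
    (second_moment (pushforward lam (T (theta t))) <= M%:E)%E)
  (t : R) (t_ge0 : 0 <= t) :
  (W2sq (pushforward lam (T (theta t))) (law (rho^~ t)) <=
   (expR ((1 + 2 * C) * t))%:E *
     W2sq (pushforward lam (T (theta 0%R))) (law (rho^~ 0%R)) +
   (2 / (1 + 2 * C) * (expR ((1 + 2 * C) * t) - 1))%:E *
     projection_error Pi sigma rho lam Theta T)%E.
Proof.
have [x xflow] := flow.
have [y [w [N [my y0 dy [mN N0 wE] lawy]]]] := regular_flow xflow.
have mT (s : R) : 0 <= s -> measurable_fun setT (T (theta s)).
  by move=> s0; have [] := T_push _ (theta_Theta s s0).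
set L := expR _; set bound := (X in (_ <= _ + X)%E).
have L0 : 0 < L by exact: expR_gt0.
(* Only the first marginal of [pi] has to be lifted to labels: the flow starts at the identity, so
   points of the second marginal are their own labels. *)
have key (pi : probability (_ * _)%type R) (eps : R) :
    coupling (pushforward lam (T (theta 0))) (law (rho^~ 0)) pi -> 0 < eps ->
    (W2sq (pushforward lam (T (theta t))) (law (rho^~ t)) <=
     L%:E * (\int[pi]_p (sqn (p.1 - p.2))%:E + eps%:E) + bound)%E.
  move=> cpi eps0.
  have cpi' : coupling (pushforward lam (T (theta 0))) lam pi.
    by move=> A mA; have [-> ->] := cpi A mA; rewrite lamE.
  have [gam [cgam dgam Egam]] := lift_coupling (mT 0 (lexx _)) cpi' eps0.
  have growth := coupled_growth rho_density rho_moment rho_gt0 lamE velocity_L2 C_gt0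
    velocity_lip T_push T_C1 jac_L2 theta_Theta theta_deriv theta_ode my y0 dy mN N0 wE
    lawy cgam dgam t_ge0.
  apply: (@le_trans _ _ (\int[gam]_p (sqn (T (theta t) p.1 - y t p.2))%:E)%E).
    apply: (W2sq_le (phi := fun p => T (theta t) p.1) (psi := fun p => y t p.2)).
    - exact: (measurableT_comp (mT t t_ge0) measurable_fst).
    - exact: (measurableT_comp (my t t_ge0) measurable_snd).
    - move=> A mA; rewrite /pushforward -(cgam _ _).1.
        by congr (gam _); apply/seteqP; split => p //= [].
      by rewrite -[X in measurable X]setTI; exact: mT.
    - move=> A mA; rewrite -(lawy t t_ge0 A mA) -(cgam _ _).2.
        by congr (gam _); apply/seteqP; split => p //= [].
      by rewrite -[X in measurable X]setTI; exact: my.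
  apply: (le_trans growth); rewrite leeD2r//.
  by apply: lee_wpmul2l; [rewrite lee_fin ltW|exact: Egam].
have delta0 : (0 <= projection_error Pi sigma rho lam Theta T)%E.
  have := projection_bound velocity_L2 T_push jac_L2 (theta_Theta 0 (lexx _)) (lexx 0).
  by apply: le_trans; apply: integral_ge0 => z _; rewrite lee_fin sqn_ge0.
have K0 : 0 < 1 + 2 * C by lra.
have bound0 : (0 <= bound)%E.
  apply: mule_ge0 => //; rewrite lee_fin; apply: mulr_ge0; first by rewrite divr_ge0// ltW.
  by rewrite subr_ge0 -[X in X <= _]expR0 ler_expR mulr_ge0// ltW.
set W0 := W2sq (pushforward lam (T (theta 0))) (law (rho^~ 0)).
have W00 : (0 <= W0)%E.
  apply: le_ereal_inf_tmp => _ [pi _ <-].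
  by apply: integral_ge0 => p _; rewrite lee_fin sqn_ge0.
(* If the initial distance is infinite, so is the right-hand side, because [L > 0] and
   [bound >= 0]. *)
have [W0oo|W0oo] := eqVneq W0 +oo%E.
  by rewrite W0oo gt0_muley ?lte_fin// addye ?leey// gt_eqF// (lt_le_trans _ bound0).
have W0fin : W0 \is a fin_num by rewrite ge0_fin_numE// lt_neqAle W0oo leey.
apply/lee_addgt0Pr => eps eps0.
(* This amount is spent twice, on a nearly optimal [pi] and on its lift; after multiplication by [L]
   the total is [eps]. *)
have eps1 : 0 < eps / (2 * L) by rewrite divr_gt0// mulr_gt0.
have [_ [pi cpi <-] Ipi] := lb_ereal_inf_adherent eps1 W0fin.
apply: (le_trans (key pi _ cpi eps1)).
apply: (@le_trans _ _ (L%:E * W0 + eps%:E + bound)%E); last by rewrite addeAC.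
apply: leeD2r.
apply: (@le_trans _ _ (L%:E * (W0 + (eps / (2 * L))%:E + (eps / (2 * L))%:E))%E).
  by apply: lee_wpmul2l; [rewrite lee_fin ltW|rewrite leeD2r// ltW].
have split_eps v : v \is a fin_num -> (L%:E * (v + (eps / (2 * L))%:E + (eps / (2 * L))%:E) =
    L%:E * v + eps%:E)%E.
  case: v => // r _.
  change ((L * (r + eps / (2 * L) + eps / (2 * L)))%:E = (L * r + eps)%:E); congr EFin.
  by field; rewrite gt_eqF.
by rewrite split_eps.
Qed.
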